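(* Let $0<\xi_0<\pi$, let $c\in\mathbb R$, and put $a=e^{ic}\sin\frac{\xi_0}{2}$. The system of functions $$\mathfrak e_{n,c}=\begin{cases} b_\kappa^{m}b_{\bar\kappa}^{m}K_{\bar\kappa}\,e^{ic}, & n=2m,\\ b_\kappa^{m}b_{\bar\kappa}^{m+1}K_{\kappa}, & n=2m+1,\end{cases}$$ forms an orthonormal basis in the Hardy space $H^2$ if $n$ runs over $\mathbb Z_+=\{0,1,2,\dots\}$, and in $L^2=L^2(\mathbb T)$ if $n$ runs over $\mathbb Z$. With respect to the basis $\{\mathfrak e_{n,c}\}_{n\in\mathbb Z}$ of $L^2$ the operator of multiplication by $v$ is the CMV matrix $\mathfrak A_a$ with constant coefficients $a_n=a$, $n\in\mathbb Z$.
   Context: $\mathbb D$ is the open unit disk, $\mathbb T$ the unit circle, $m$ the normalized Lebesgue measure on $\mathbb T$, $L^2=L^2(\mathbb T,dm)$, and $H^2\subset L^2$ the standard Hardy space of the disk. Let $E=\{e^{i\xi}:\xi_0\le\xi\le2\pi-\xi_0\}$ and $\Omega=\overline{\mathbb C}\setminus E$. Let $\kappa=-i\tan\frac{\pi-\xi_0}{4}\in\mathbb D$, $$b_\kappa(\zeta)=\frac1i\,\frac{\zeta-\kappa}{1-\zeta\bar\kappa},\qquad b_{\bar\kappa}(\zeta)=i\,\frac{\zeta-\bar\kappa}{1-\zeta\kappa},\qquad v(\zeta)=\frac{b_\kappa(\zeta)}{b_{\bar\kappa}(\zeta)}.$$ ($v$ is the conformal map of $\mathbb D$ onto $\Omega$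 given by $2\tan\frac{\xi_0}2\; i\frac{1+v}{1-v}=\zeta+\frac1\zeta$, with $v(\kappa)=0$, $v(\bar\kappa)=\infty$.) For $\zeta_0\in\mathbb D$, $K_{\zeta_0}(\zeta)=\frac{\sqrt{1-|\zeta_0|^2}}{1-\zeta\bar\zeta_0}$ is the normalized reproducing kernel of $H^2$. CMV matrices. For a sequence $\{a_n\}_{n\in\mathbb Z}\subset\mathbb D$ put $\rho_j=\sqrt{1-|a_j|^2}$ and $A_j=\begin{bmatrix}\overline{a_j}&\rho_j\\ \rho_j&-a_j\end{bmatrix}$. Let $|n\rangle$, $n\in\mathbb Z$, be the standard basis of $l^2(\mathbb Z)$. $\mathfrak A_0$ is the block-diagonal unitary operator acting as $A_{2k}$ on $\mathrm{span}(|2k\rangle,|2k+1\rangle)$, $k\in\mathbb Z$; $\mathfrak A_1$ is the block-diagonal unitary operator acting as $A_{2k-1}$ on $\mathrm{span}(|2k-1\rangle,|2k\rangle)$, $k\in\mathbb Z$. The CMV matrix is $\mathfrak A(\{a_n\})=\mathfrak A_0\mathfrak A_1$. *)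

(* Defs.v *)
From mathcomp Require Import all_boot all_order all_algebra.
From mathcomp Require Import complex.
From mathcomp Require Import all_classical all_reals all_analysis.

Set Implicit Arguments.
Unset Strict Implicit.
Unset Printing Implicit Defensive.

Import Order.TTheory GRing.Theory Num.Theory.

Local Open Scope classical_set_scope.
Local Open Scope ring_scope.

Section CircleSpaces.
Context {R : realType}.
Implicit Types f g : R[i] -> R[i].

Lemma two_pi_gt0 : 0 < 2 * pi :> R.
Proof. by rewrite mulr_gt0 ?pi_gt0. Qed.

Definition expi (t : R) : R[i] := (cos t +i* sin t)%C.

(* The normalized Lebesgue measure on the circle, read through the
   parametrization [t |-> expi t], t in [0, 2 pi]. *)
Definition circ : probability _ R := uniform_prob two_pi_gt0.

(* Functions on the circle are represented by functions on the complex plane,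
   of which only the values on the circle are used; elements of L^2 are equal
   when they agree almost everywhere, and nothing below distinguishes
   representatives of the same class. *)
Definition L2 f : Prop :=
  (fun t => complex.Re (f (expi t))) \in Lfun circ 2%:E /\
  (fun t => complex.Im (f (expi t))) \in Lfun circ 2%:E.

Definition dotC f g : R[i] :=
  ((\int[circ]_t complex.Re (f (expi t) * (g (expi t))^*)) +i*
   (\int[circ]_t complex.Im (f (expi t) * (g (expi t))^*)))%C.

Definition L2norm f : R := Num.sqrt (complex.Re (dotC f f)).

(* H^2 as a subspace of L^2: the negative Fourier coefficients vanish. *)
Definition H2 f : Prop :=
  L2 f /\ forall k : int, k < 0 -> dotC f (fun z => z ^ k) = 0.

(* An orthonormal family in the closed subspace V of L^2 whose finite linear
   combinations are dense in V. *)
Definition orthonormal_basis (I : eqType) (V : (R[i] -> R[i]) -> Prop)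
    (e : I -> R[i] -> R[i]) : Prop :=
  [/\ forall i, V (e i),
      forall i j, dotC (e i) (e j) = (i == j)%:R
    & forall f, V f -> forall eps : R, 0 < eps ->
        exists (s : seq I) (l : I -> R[i]),
          L2norm (fun z => f z - \sum_(i <- s) l i * e i z) < eps].

Definition coord (I : Type) (e : I -> R[i] -> R[i]) f : I -> R[i] :=
  fun i => dotC f (e i).

(* [M] maps the coordinate sequence of [f] in the orthonormal basis [e] of L^2
   to that of [T f]; for a matrix [M] this says that the columns of [M] are the
   coordinates of the [T (e n)]. *)
Definition operator_in_basis (I : Type) (e : I -> R[i] -> R[i])
    (T : (R[i] -> R[i]) -> R[i] -> R[i]) (M : (I -> R[i]) -> I -> R[i]) :=
  forall f, L2 f -> L2 (T f) /\ coord e (T f) = M (coord e f).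

Definition mul_op (w f : R[i] -> R[i]) : R[i] -> R[i] := fun z => w z * f z.

End CircleSpaces.

Section CMV.
Context {R : realType}.
Implicit Types (a x : int -> R[i]).

Definition even_int (n : int) : bool := (2 %| n)%Z.

Definition cmv_rho a (j : int) : R[i] := sqrtC (1 - `|a j| ^+ 2).

Definition cmv_coef a (j : int) : 'M[R[i]]_2 :=
  \matrix_(r < 2, s < 2)
    if r == 0 then (if s == 0 then (a j)^* else cmv_rho a j)
    else (if s == 0 then cmv_rho a j else - a j).

(* The operator on sequences acting as [cmv_coef a j] on the coordinates
   (j, j+1) for all j whose evenness is [b]. *)
Definition cmv_factor (b : bool) a x : int -> R[i] := fun n =>
  if even_int n == b then
    cmv_coef a n 0 0 * x n + cmv_coef a n 0 1 * x (n + 1)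
  else
    cmv_coef a (n - 1) 1 0 * x (n - 1) + cmv_coef a (n - 1) 1 1 * x n.

Definition cmv a : (int -> R[i]) -> int -> R[i] :=
  cmv_factor true a \o cmv_factor false a.

End CMV.

Section ArcSystem.
Context {R : realType}.
Variable xi0 : R.

Definition kappa : R[i] := - 'i * (tan ((pi - xi0) / 4))%:C%C.

Definition b_kappa (z : R[i]) : R[i] :=
  'i^-1 * ((z - kappa) / (1 - z * kappa^*)).

Definition b_kappabar (z : R[i]) : R[i] :=
  'i * ((z - kappa^*) / (1 - z * kappa)).

Definition v_map (z : R[i]) : R[i] := b_kappa z / b_kappabar z.

Definition hardy_kernel (z0 z : R[i]) : R[i] :=
  sqrtC (1 - `|z0| ^+ 2) / (1 - z * z0^*).

Definition e_sys (c : R) (n : int) (z : R[i]) : R[i] :=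
  let m := (n %/ 2)%Z in
  if even_int n then
    b_kappa z ^ m * b_kappabar z ^ m * hardy_kernel (kappa^*) z * expi c
  else
    b_kappa z ^ m * b_kappabar z ^ (m + 1) * hardy_kernel kappa z.

End ArcSystem.

(* Main.v *)
(** Put [y = - kappa] and [B = b_kappa b_kappabar]. On the circle [B] is
    unimodular, and the system is [e_(2m+r) = B^m E_r] with [E_0 = e^(ic) K_kappabar]
    and [E_1 = b_kappabar K_kappa].

    Orthonormality: [B conj(E_r)] is [z] times a function of the disc algebra, so
    [e_n conj(e_n')] is also of this form when [n > n'] and its mean is its value
    [0] at the origin; [|E_r|^2] is a Poisson kernel, of mean [1].

    Completeness: [span(E_0, E_1)] is spanned by [1 / D] and [z / D] with
    [D = 1 - y^2 z^2], and [B = (z^2 - y^2) / (1 - y^2 z^2)] is a Moebius function of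
    [z^2]; inverting it, [z^(2j) D] is a uniform limit of polynomials in [B] or in
    [1 / B], so every [z^k] is a uniform limit of combinations of the [e_n].
    Trigonometric polynomials are dense in [L^2] because iterating an odd polynomial
    on [sin (t/2) sin ((t-a)/2)] converges boundedly to the sign of [t - a], hence
    yields the indicators of half-lines, then of all Borel sets. In [H^2] the terms
    with [n < 0] of an approximant are orthogonal to everything else and can be
    dropped.

    Matrix: the two relations [s K_kappa + rho b_kappa K_kappabar = K_kappabar] and
    [rho K_kappa - s b_kappa K_kappabar = b_kappabar K_kappa], [s = |a|], applied
    twice give the expansion of [v^-1 e_n], that is, the rows of the matrix. *)

Require Import Defs.
From mathcomp Require Import all_boot all_order all_algebra.
From mathcomp Require Import complex.
From mathcomp Require Import all_classical all_reals all_analysis.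
From mathcomp Require Import measurable_realfun.
From mathcomp Require Import zify ring lra.

Set Implicit Arguments.
Unset Strict Implicit.
Unset Printing Implicit Defensive.

Import Order.TTheory GRing.Theory Num.Theory.
Import numFieldNormedType.Exports.

Local Open Scope classical_set_scope.
Local Open Scope ring_scope.

#[local] Notation Re := complex.Re.
#[local] Notation Im := complex.Im.

(** * Complex-valued measurable and integrable functions *)

Section NormSquare.
Context {R : realType}.
Implicit Types x y z : R[i].

Lemma real_complex_inj (r s : R) : r%:C%C = s%:C%C :> R[i] -> r = s.
Proof. by case. Qed.

(** The norm on [R[i]] takes its values in [R[i]]; integrals need the squared modulus as an element
    of [R]. *)
Definition nsq z : R := Re z ^+ 2 + Im z ^+ 2.

Lemma nsq_ge0 z : 0 <= nsq z.
Proof. by rewrite addr_ge0 ?sqr_ge0. Qed.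

Lemma nsqE z : (nsq z)%:C%C = `|z| ^+ 2.
Proof. exact: add_Re2_Im2. Qed.

Lemma nsq_le x y : (nsq x <= nsq y) = (`|x| <= `|y|).
Proof. by rewrite -lecR !nsqE ler_pXn2r ?nnegrE. Qed.

Lemma nsq_real (r : R) : nsq r%:C%C = r ^+ 2.
Proof. by rewrite /nsq /= expr0n addr0. Qed.

Lemma nsqM x y : nsq (x * y) = nsq x * nsq y.
Proof. by apply: real_complex_inj; rewrite rmorphM /= !nsqE normrM exprMn. Qed.

Lemma nsqJ z : nsq z^* = nsq z.
Proof. by apply: real_complex_inj; rewrite !nsqE norm_conjC. Qed.

(** By the parallelogram law the difference of the two sides is [nsq (x - y)]. *)
Lemma nsqD_le x y : nsq (x + y) <= 2 * nsq x + 2 * nsq y.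
Proof.
case: x y => [a b] [c d]; rewrite -subr_ge0.
apply: (le_trans (nsq_ge0 ((a - c) +i* (b - d))%C)).
by rewrite /nsq /= le_eqVlt; apply/orP; left; apply/eqP; ring.
Qed.

Lemma mul_conjC_nsq z : z * z^* = (nsq z)%:C%C.
Proof. by rewrite nsqE normCK. Qed.

Lemma nsq_Re_mulJ z : Re (z * z^*) = nsq z.
Proof. by rewrite mul_conjC_nsq. Qed.

Lemma Re_conj z : Re z^* = Re z. Proof. by case: z. Qed.
Lemma Im_conj z : Im z^* = - Im z. Proof. by case: z. Qed.
Lemma ReD x y : Re (x + y) = Re x + Re y. Proof. by case: x; case: y. Qed.
Lemma ImD x y : Im (x + y) = Im x + Im y. Proof. by case: x; case: y. Qed.
Lemma ReM x y : Re (x * y) = Re x * Re y - Im x * Im y.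
Proof. by case: x; case: y. Qed.
Lemma ImM x y : Im (x * y) = Re x * Im y + Im x * Re y.
Proof. by case: x; case: y. Qed.

Lemma ReIm_le (r : R) z : `|z| <= r%:C%C -> `|Re z| <= r /\ `|Im z| <= r.
Proof.
move=> zr.
have r0 : 0 <= r by rewrite -ler0c (le_trans _ zr).
have : nsq z <= r ^+ 2.
  by rewrite -nsq_real nsq_le [leRHS]ger0_norm ?ler0c.
rewrite /nsq => h.
by split; rewrite -(@ler_pXn2r _ 2) ?nnegrE// ?real_normK ?num_real//;
  apply: le_trans h; rewrite ?lerDl ?lerDr sqr_ge0.
Qed.

End NormSquare.

Section ComplexMeasurable.
Context {d} {T : measurableType d} {R : realType}.
Implicit Types f g h : T -> R[i].

(** Measurability is taken componentwise, so that only the Borel structure of [R] is involved. *)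
Definition mC h := measurable_fun setT (fun t => Re (h t)) /\
  measurable_fun setT (fun t => Im (h t)).

Lemma eq_mC f g : f =1 g -> mC f -> mC g.
Proof. by move=> /funext ->. Qed.

Lemma mC_cst z : mC (fun=> z).
Proof. by split; exact: measurable_cst. Qed.

Lemma mC_real (f : T -> R) : measurable_fun setT f -> mC (fun t => (f t)%:C%C).
Proof. by move=> mf; split => //=; exact: measurable_cst. Qed.

Lemma mCD f g : mC f -> mC g -> mC (fun t => f t + g t).
Proof.
move=> [f1 f2] [g1 g2]; split.
  by under eq_fun do rewrite ReD; exact: measurable_funD.
by under eq_fun do rewrite ImD; exact: measurable_funD.
Qed.

Lemma mCM f g : mC f -> mC g -> mC (fun t => f t * g t).
Proof.
move=> [f1 f2] [g1 g2]; split.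
  under eq_fun do rewrite ReM.
  by apply: measurable_funB; exact: measurable_funM.
under eq_fun do rewrite ImM.
by apply: measurable_funD; exact: measurable_funM.
Qed.

Lemma mCN f : mC f -> mC (fun t => - f t).
Proof.
move=> mf; apply: (eq_mC (f := fun t => -1 * f t)) => [t|]; first exact: mulN1r.
by apply: mCM => //; exact: mC_cst.
Qed.

Lemma mCB f g : mC f -> mC g -> mC (fun t => f t - g t).
Proof. by move=> mf mg; apply: mCD => //; exact: mCN. Qed.

Lemma mCJ f : mC f -> mC (fun t => (f t)^*).
Proof.
move=> [f1 f2]; split; first by under eq_fun do rewrite Re_conj.
by under eq_fun do rewrite Im_conj; exact: measurable_funN.
Qed.

Lemma mC_nsq f : mC f -> measurable_fun setT (fun t => nsq (f t)).
Proof. by move=> [f1 f2]; apply: measurable_funD; exact: measurable_funX. Qed.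

(** Write 1/f as conj(f) / |f|^2, which is also right at the zeros of [f], where both sides are 0.
    The real inverse is measurable as a power function with exponent -1. *)
Lemma mCV f : mC f -> mC (fun t => (f t)^-1).
Proof.
move=> mf; apply: (eq_mC (f := fun t => (f t)^* * ((nsq (f t))^-1)%:C%C)).
  move=> t; rewrite fmorphV/= nsqE.
  have [->|f0] := eqVneq (f t) 0; first by rewrite invr0 conjC0 mul0r.
  by rewrite normCK invfM mulrCA mulfV ?mulr1// conjC_eq0.
apply: mCM; first exact: mCJ.
apply: mC_real; apply: (eq_measurable_fun (fun t => nsq (f t) `^ (-1))).
  by move=> t _ /=; rewrite powR_inv1// nsq_ge0.
exact: (measurableT_comp (measurable_powR (-1)) (mC_nsq mf)).
Qed.

Lemma mCX f n : mC f -> mC (fun t => f t ^+ n).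
Proof.
move=> mf; elim: n => [|n IH]; first exact: mC_cst.
by apply: (eq_mC (f := fun t => f t * f t ^+ n)) => [t|];
  [rewrite exprS|exact: mCM].
Qed.

Lemma mCXz f (n : int) : mC f -> mC (fun t => f t ^ n).
Proof. by case: n => n mf; [|apply: mCV]; exact: mCX. Qed.

Lemma mC_sum I (s : seq I) (F : I -> T -> R[i]) :
  (forall i, mC (F i)) -> mC (fun t => \sum_(i <- s) F i t).
Proof.
move=> mF; elim: s => [|i s IH].
  by apply: (eq_mC (f := fun=> 0)) => [t|]; [rewrite big_nil|exact: mC_cst].
by apply: (eq_mC (f := fun t => F i t + \sum_(i <- s) F i t)) => [t|];
  [rewrite big_cons|exact: mCD].
Qed.

End ComplexMeasurable.

Section ComplexIntegral.
Context {d} {T : measurableType d} {R : realType}.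
Variable mu : probability T R.
Implicit Types (f g h : T -> R[i]) (b : T -> R).

Definition integC h := mu.-integrable setT (fun t => (Re (h t))%:E) /\
  mu.-integrable setT (fun t => (Im (h t))%:E).

Definition cint h : R[i] :=
  ((\int[mu]_t Re (h t)) +i* (\int[mu]_t Im (h t)))%C.

(** Square integrability on an arbitrary probability space; on the circle it amounts to [L2], by
    [L2P]. *)
Definition sqint h := mC h /\ mu.-integrable setT (fun t => (nsq (h t))%:E).

Lemma eq_integC f g : f =1 g -> integC f -> integC g.
Proof. by move=> /funext ->. Qed.

Lemma eq_cint f g : f =1 g -> cint f = cint g.
Proof. by move=> /funext ->. Qed.

Lemma eq_sqint f g : f =1 g -> sqint f -> sqint g.
Proof. by move=> /funext ->. Qed.

Lemma integC_le h b : mC h -> mu.-integrable setT (EFin \o b) ->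
  (forall t, `|h t| <= (b t)%:C%C) -> integC h.
Proof.
move=> [h1 h2] ib hb; split; apply: (le_integrable measurableT _ _ ib).
- exact/measurable_EFinP.
- move=> t _ /=; rewrite lee_fin; have [h3 _] := ReIm_le (hb t).
  by rewrite (le_trans h3)// ler_norm.
- exact/measurable_EFinP.
- move=> t _ /=; rewrite lee_fin; have [_ h3] := ReIm_le (hb t).
  by rewrite (le_trans h3)// ler_norm.
Qed.

Lemma integrable_cst_prob (r : R) : mu.-integrable setT (EFin \o cst r).
Proof. by apply: finite_measure_integrable_cst. Qed.

Lemma integC_bounded h (r : R) : mC h -> (forall t, `|h t| <= r%:C%C) -> integC h.
Proof. by move=> mh; exact: (integC_le mh (integrable_cst_prob r)). Qed.

Lemma integC_cst z : integC (fun=> z).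
Proof. by split; exact: integrable_cst_prob. Qed.

Lemma integCD f g : integC f -> integC g -> integC (fun t => f t + g t).
Proof.
move=> [f1 f2] [g1 g2]; split.
  under eq_fun do rewrite ReD EFinD; exact: integrableD.
by under eq_fun do rewrite ImD EFinD; exact: integrableD.
Qed.

Lemma integCZ z f : integC f -> integC (fun t => z * f t).
Proof.
move=> [f1 f2]; split.
  under eq_fun do rewrite ReM EFinB !EFinM.
  by apply: integrableB => //; exact: integrableZl.
under eq_fun do rewrite ImM EFinD !EFinM.
by apply: integrableD => //; exact: integrableZl.
Qed.

Lemma integCN f : integC f -> integC (fun t => - f t).
Proof.
move=> /(integCZ (-1)); apply: eq_integC => t; exact: mulN1r.
Qed.

Lemma cintD f g : integC f -> integC g ->
  cint (fun t => f t + g t) = cint f + cint g.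
Proof.
move=> [f1 f2] [g1 g2]; rewrite /cint.
under eq_Rintegral do rewrite ReD.
under [X in (_ +i* X)%C]eq_Rintegral do rewrite ImD.
by rewrite !RintegralD.
Qed.

Lemma cintZ z f : integC f -> cint (fun t => z * f t) = z * cint f.
Proof.
move=> [f1 f2]; rewrite /cint.
under eq_Rintegral do rewrite ReM.
under [X in (_ +i* X)%C]eq_Rintegral do rewrite ImM.
have i1 r : mu.-integrable setT (fun t => (r * Re (f t))%:E).
  by under eq_fun do rewrite EFinM; exact: integrableZl.
have i2 r : mu.-integrable setT (fun t => (r * Im (f t))%:E).
  by under eq_fun do rewrite EFinM; exact: integrableZl.
rewrite (RintegralB measurableT (i1 _) (i2 _)) (RintegralD measurableT (i2 _) (i1 _)).
by rewrite !RintegralZl//; case: z {i1 i2}.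
Qed.

Lemma cintN f : integC f -> cint (fun t => - f t) = - cint f.
Proof.
by move=> /(cintZ (-1)); rewrite mulN1r => <-; apply: eq_cint => t; rewrite mulN1r.
Qed.

Lemma cintB f g : integC f -> integC g ->
  cint (fun t => f t - g t) = cint f - cint g.
Proof. by move=> mf mg; rewrite cintD ?cintN//; exact: integCN. Qed.

Lemma cint_cst z : cint (fun=> z) = z.
Proof.
rewrite /cint !Rintegral_cst//=.
have -> : mu setT = 1%E by exact: probability_setT.
by rewrite !mulr1; case: z.
Qed.

Lemma cint_sum I (s : seq I) (F : I -> T -> R[i]) : (forall i, integC (F i)) ->
  integC (fun t => \sum_(i <- s) F i t) /\
  cint (fun t => \sum_(i <- s) F i t) = \sum_(i <- s) cint (F i).
Proof.
move=> mF; elim: s => [|i s [IH1 IH2]].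
  have E : (fun=> 0) =1 (fun t => \sum_(i <- [::]) F i t) by move=> t; rewrite big_nil.
  rewrite -(eq_cint E) cint_cst big_nil; split=> //.
  by apply: eq_integC E _; exact: integC_cst.
have E : (fun t => F i t + \sum_(i <- s) F i t) =1
    (fun t => \sum_(i <- i :: s) F i t) by move=> t; rewrite big_cons.
rewrite -(eq_cint E) cintD// big_cons IH2; split=> //.
by apply: eq_integC E _; exact: integCD.
Qed.

Lemma cintJ f : integC f -> cint (fun t => (f t)^*) = (cint f)^*.
Proof.
move=> [f1 f2]; rewrite /cint.
under eq_Rintegral do rewrite Re_conj.
under [X in (_ +i* X)%C]eq_Rintegral do rewrite Im_conj -mulN1r.
by rewrite RintegralZl// mulN1r.
Qed.

(** Bounding the two parts separately avoids rotating the integral; [small_eq0] takes its hypothesis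
    in this form. *)
Lemma cint_le h b : mC h -> mu.-integrable setT (EFin \o b) ->
  (forall t, `|h t| <= (b t)%:C%C) ->
  `|Re (cint h)| <= \int[mu]_t b t /\ `|Im (cint h)| <= \int[mu]_t b t.
Proof.
move=> mh ib hb; have [i1 i2] := integC_le mh ib hb.
split=> /=.
  apply: (le_trans (le_normr_Rintegral measurableT i1)).
  apply: le_Rintegral => //; first exact: (integrable_norm i1).
  by move=> t _; have [] := ReIm_le (hb t).
apply: (le_trans (le_normr_Rintegral measurableT i2)).
apply: le_Rintegral => //; first exact: (integrable_norm i2).
by move=> t _; have [] := ReIm_le (hb t).
Qed.

Lemma sqint_bounded h (r : R) : mC h -> (forall t, `|h t| <= r%:C%C) -> sqint h.
Proof.
move=> mh hb; split=> //.
apply: (le_integrable measurableT _ _ (integrable_cst_prob (r ^+ 2))).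
  exact/measurable_EFinP/mC_nsq.
move=> t _ /=; rewrite lee_fin !ger0_norm ?nsq_ge0 ?sqr_ge0//.
by rewrite -nsq_real nsq_le (le_trans (hb t))// real_ler_norm// complex_real.
Qed.

Lemma sqintD f g : sqint f -> sqint g -> sqint (fun t => f t + g t).
Proof.
move=> [mf f2] [mg g2]; have mfg := mCD mf mg; split=> //.
apply: (@le_integrable _ _ _ mu _ measurableT _
  (fun t => (2%:E * (nsq (f t))%:E + 2%:E * (nsq (g t))%:E)%E)).
- exact/measurable_EFinP/mC_nsq.
- move=> t _; rewrite -!EFinM -EFinD !abse_EFin lee_fin !ger0_norm ?nsq_ge0//.
    exact: nsqD_le.
  by rewrite addr_ge0// mulr_ge0// nsq_ge0.
- by apply: integrableD => //; exact: integrableZl.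
Qed.

Lemma sqintZ z f : sqint f -> sqint (fun t => z * f t).
Proof.
move=> [mf f2]; split; first by apply: mCM => //; exact: mC_cst.
by under eq_fun do rewrite nsqM EFinM; exact: integrableZl.
Qed.

Lemma sqintB f g : sqint f -> sqint g -> sqint (fun t => f t - g t).
Proof.
move=> sf sg; apply: sqintD => //.
by apply: eq_sqint (sqintZ (-1) sg) => t; exact: mulN1r.
Qed.

Lemma sqint_sum I (s : seq I) (F : I -> T -> R[i]) :
  (forall i, sqint (F i)) -> sqint (fun t => \sum_(i <- s) F i t).
Proof.
move=> mF; elim: s => [|i s IH].
  have E : (fun=> 0) =1 (fun t => \sum_(i <- [::]) F i t) by move=> t; rewrite big_nil.
  apply: eq_sqint E _; apply: (sqint_bounded (r := 0)) => [|t]; first exact: mC_cst.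
  by rewrite normr0.
have E : (fun t => F i t + \sum_(i <- s) F i t) =1
    (fun t => \sum_(i <- i :: s) F i t) by move=> t; rewrite big_cons.
by apply: eq_sqint E _; exact: sqintD.
Qed.

(** Domination by |f|^2 + |g|^2: for the squared moduli [x] and [y], both nonnegative, one has
    [x y <= (x + y)^2]. *)
Lemma sqint_mulJ f g : sqint f -> sqint g -> integC (fun t => f t * (g t)^*).
Proof.
move=> [mf f2] [mg g2].
apply: (integC_le (b := fun t => nsq (f t) + nsq (g t))).
- by apply: mCM => //; exact: mCJ.
- rewrite (_ : _ \o _ = (fun t => (nsq (f t))%:E + (nsq (g t))%:E)%E)//.
  exact: integrableD.
- move=> t; have := nsq_ge0 (f t); have := nsq_ge0 (g t).
  set x := nsq (f t); set y := nsq (g t) => y0 x0.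
  have xy0 : (0 : R[i]) <= (x + y)%:C%C by rewrite ler0c addr_ge0.
  rewrite -[leRHS]ger0_norm// -nsq_le nsqM nsqJ nsq_real -/x -/y; nra.
Qed.

End ComplexIntegral.

(** * The circle *)

Section Circle.
Context {R : realType}.
Implicit Types (f g : R[i] -> R[i]) (t : R).

Lemma norm_expi t : `|expi t| = 1.
Proof. by rewrite normc_def /= cos2Dsin2 sqrtr1. Qed.

Lemma expi_neq0 t : expi t != 0.
Proof. by rewrite -normr_eq0 norm_expi oner_eq0. Qed.

Lemma expiD s t : expi (s + t) = expi s * expi t.
Proof.
by rewrite /expi cosD sinD; congr (_ +i* _)%C; rewrite addrC [sin s * _]mulrC.
Qed.

Lemma expiX t n : expi t ^+ n = expi (n%:R * t).
Proof.
elim: n => [|n IH]; first by rewrite mul0r /expi cos0 sin0.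
by rewrite exprS IH -expiD -[in RHS]natr1 mulrDl mul1r addrC.
Qed.

Lemma conj_expi t : (expi t)^* = (expi t)^-1.
Proof. by rewrite invC_norm norm_expi expr1n invr1 mul1r. Qed.

Lemma mC_expi : mC (@expi R : measurableTypeR R -> R[i]).
Proof.
by split; apply: continuous_measurable_fun; [exact: continuous_cos|exact: continuous_sin].
Qed.

Lemma integral_circ_derive (h H : R -> R) : continuous h ->
  (forall t, is_derive t 1 H (h t)) -> H 0 = H (2 * pi) ->
  (forall t, -1 <= h t <= 1) -> \int[circ]_t h t = 0.
Proof.
move=> ch dH H02 hb.
have mh := continuous_measurable_fun ch.
have i1 : circ.-integrable setT (EFin \o cst (1 : R)) by exact: integrable_cst_prob.
have ih : circ.-integrable setT (EFin \o h).
  apply: (le_integrable measurableT _ _ i1); first exact/measurable_EFinP.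
  by move=> t _ /=; rewrite lee_fin normr1 ler_norml.
(* [integral_uniform] is applied to a nonnegative integrand: 1 is added on both sides, and [1 + h],
   nonnegative by the lower bound on [h], has the primitive [t + H t]. *)
apply: (@addrI _ 1).
rewrite -[X in X + _ = _](_ : \int[circ]_t (cst 1 t) = 1); last first.
  by rewrite Rintegral_cst// (_ : _ setT = 1%E) ?mul1r//; exact: probability_setT.
rewrite -RintegralD// addr0 /Rintegral integral_uniform; last 2 first.
- by apply/measurable_EFinP; apply: measurable_funD.
- by move=> t; rewrite lee_fin /= -lerBlDl sub0r; case/andP: (hb t).
have pi0 := two_pi_gt0 (R := R).
rewrite (@continuous_FTC2 _ _ (fun t => t + H t))//=.
- by rewrite -H02 add0r addrK subr0 mulVf// gt_eqF.
- by apply: continuous_subspaceT => t; apply: cvgD; [exact: cvg_cst|exact: ch].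
- have dd t : derivable (fun t => t + H t) t 1.
    by apply: derivableD; [exact: derivable_id|case: (dH t)].
  have cc t : {for t, continuous (fun t => t + H t)}.
    by apply/differentiable_continuous; rewrite -derivable1_diffP.
  split; first by move=> t _; exact: dd.
  + by apply: cvg_at_right_filter; exact: cc.
  + by apply: cvg_at_left_filter; exact: cc.
- move=> t _; rewrite derive1E; have dt := dH t; exact: derive_val.
Qed.

Lemma cint_expi n : cint circ (fun t => expi t ^+ n) = (n == 0)%:R.
Proof.
case: n => [|n].
  rewrite -[RHS](cint_cst (@circ R)); apply: eq_cint => t; by rewrite expr0.
rewrite (eq_cint circ (g := fun t => expi (n.+1%:R * t))); last first.
  by move=> t; rewrite expiX.
have n0 : n.+1%:R != 0 :> R by rewrite pnatr_eq0.
have per : n.+1%:R * (2 * pi) = 0 + (pi *+ 2) *+ n.+1 :> R.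
  by rewrite add0r -[in RHS]mulr_natl -[pi *+ 2]mulr_natl.
rewrite /cint /=; congr (_ +i* _)%C.
  apply: (integral_circ_derive (H := fun t => n.+1%:R^-1 * sin (n.+1%:R * t))).
  - move=> t; apply: continuous_comp; last exact: continuous_cos.
    exact: mulrl_continuous.
  - move=> t; apply: is_derive_eq; rewrite /GRing.scale/= mulr1.
    by rewrite mulrCA mulVf// mulr1.
  - by rewrite per (periodicn (@sinD2pi R)) mulr0.
  - by move=> t; rewrite cos_geN1 cos_le1.
apply: (integral_circ_derive (H := fun t => - (n.+1%:R^-1 * cos (n.+1%:R * t)))).
- move=> t; apply: continuous_comp; last exact: continuous_sin.
  exact: mulrl_continuous.
- move=> t; apply: is_derive_eq; rewrite /GRing.scale/= mulr1.
  by rewrite mulNr mulrN opprK mulrCA mulVf// mulr1.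
- by rewrite per (periodicn (@cosD2pi R)) mulr0.
- by move=> t; rewrite sin_geN1 sin_le1.
Qed.

Lemma eq_cint_circ (h k : R -> R[i]) : h =1 k -> cint circ h = cint circ k.
Proof. by move=> /funext ->. Qed.

Lemma dotCE f g : dotC f g = cint circ (fun t => f (expi t) * (g (expi t))^*).
Proof. by []. Qed.

Lemma L2P f : L2 f <-> sqint circ (fun t => f (expi t)).
Proof.
split=> [[/[dup] /Lfun2_integrable_sqr i1 r1 /[dup] /Lfun2_integrable_sqr i2 r2]|].
  move: r1 r2; rewrite !inE => /andP[/[!inE]/= m1 _] /andP[/[!inE]/= m2 _].
  split; first by [].
  rewrite (_ : (fun _ => _) = (fun t => (Re (f (expi t)) ^+ 2)%:E +
    (Im (f (expi t)) ^+ 2)%:E)%E)//.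
  exact: integrableD.
have L (h : R -> R) : measurable_fun setT h ->
    circ.-integrable setT (fun t => (h t ^+ 2)%:E) -> h \in Lfun circ 2%:E.
  move=> mh /integrableP[_ fi].
  rewrite inE; apply/andP; split; rewrite inE//= /finite_norm unlock.
  rewrite poweR_lty//.
  apply: le_lt_trans fi; rewrite le_eqVlt; apply/orP; left; apply/eqP.
  apply: eq_integral => t _.
  by rewrite /= powR_mulrn// normrX.
move=> [[m1 m2] i]; split; apply: L => //.
  apply: (le_integrable measurableT _ _ i); first exact/measurable_EFinP/measurable_funX.
  move=> t _ /=; rewrite lee_fin !ger0_norm ?sqr_ge0 ?nsq_ge0//.
  by rewrite lerDl sqr_ge0.
apply: (le_integrable measurableT _ _ i); first exact/measurable_EFinP/measurable_funX.
move=> t _ /=; rewrite lee_fin !ger0_norm ?sqr_ge0 ?nsq_ge0//.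
by rewrite lerDr sqr_ge0.
Qed.

Lemma L2normE f : L2norm f = Num.sqrt (\int[circ]_t nsq (f (expi t))).
Proof. by congr Num.sqrt; apply: eq_Rintegral => t _; rewrite nsq_Re_mulJ. Qed.

End Circle.

(** * Uniform limits of polynomials and the mean value property *)

Section UniformApproximation.
Context {R : realType} {X : Type}.
Variables (D : set X) (u : X -> R[i]).
Implicit Types (f g : X -> R[i]) (e w : R[i]) (p q : {poly R[i]}).

(** With [u] the identity on the closed disc this gives the disc algebra; with [u] the function [B]
    or its inverse along the circle, it gives what the powers of [B] approximate. In [R[i]] the
    condition [0 < e] makes [e] real. *)
Definition poly_limit f := forall e, 0 < e ->
  exists p, forall x, D x -> `|f x - p.[u x]| <= e.

Lemma eq_poly_limit f g : (forall x, D x -> f x = g x) ->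
  poly_limit f -> poly_limit g.
Proof.
move=> fg lf e e0; have [p hp] := lf e e0; exists p => x Dx.
by rewrite -fg// hp.
Qed.

Lemma poly_limit_cst w : poly_limit (fun=> w).
Proof.
by move=> e e0; exists w%:P => x _; rewrite hornerC subrr normr0 ltW.
Qed.

Lemma poly_limit_id : poly_limit u.
Proof. by move=> e e0; exists 'X => x _; rewrite hornerX subrr normr0 ltW. Qed.

Lemma poly_limitD f g : poly_limit f -> poly_limit g ->
  poly_limit (fun x => f x + g x).
Proof.
move=> lf lg e e0; have e20 : 0 < e / 2 by rewrite divr_gt0.
have [p hp] := lf _ e20; have [q hq] := lg _ e20.
exists (p + q) => x Dx; rewrite hornerD opprD addrACA [leRHS]splitr.
by rewrite (le_trans (ler_normD _ _))// lerD ?hp ?hq.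
Qed.

Hypothesis u_le1 : forall x, D x -> `|u x| <= 1.

Lemma horner_bounded p : exists2 M : R[i], 0 < M &
  forall x, D x -> `|p.[u x]| <= M.
Proof.
(* The summand 1 keeps the bound positive even for [p = 0]; it serves as a divisor in
   [poly_limitM]. *)
exists (1 + \sum_(i < size p) `|p`_i|) => [|x Dx].
  by rewrite ltr_pwDl// sumr_ge0.
rewrite horner_coef (le_trans (ler_norm_sum _ _ _))// -[leLHS]add0r lerD//.
apply: ler_sum => i _; rewrite normrM normrX ler_piMr// exprn_ile1//.
exact: u_le1.
Qed.

Lemma poly_limit_bounded f : poly_limit f -> exists2 M : R[i], 0 < M &
  forall x, D x -> `|f x| <= M.
Proof.
move=> /(_ 1 ltr01) [p hp]; have [M M0 hM] := horner_bounded p.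
exists (1 + M) => [|x Dx]; first by rewrite addr_gt0.
rewrite -[f x](subrK p.[u x]) (le_trans (ler_normD _ _))// lerD//.
  exact: hp.
exact: hM.
Qed.

(** f g - p q = (f - p) g + p (g - q): [p] is chosen against a bound of [g], and only then [q]
    against a bound of that [p]. *)
Lemma poly_limitM f g : poly_limit f -> poly_limit g ->
  poly_limit (fun x => f x * g x).
Proof.
move=> lf lg e e0; have e20 : 0 < e / 2 by rewrite divr_gt0.
have [M M0 hM] := poly_limit_bounded lg.
have [p hp] := lf _ (divr_gt0 e20 M0).
have [N N0 hN] := horner_bounded p.
have [q hq] := lg _ (divr_gt0 e20 N0).
exists (p * q) => x Dx; rewrite hornerM.
rewrite (_ : _ - _ = (f x - p.[u x]) * g x + p.[u x] * (g x - q.[u x])); last by ring.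
rewrite (le_trans (ler_normD _ _))// !normrM [leRHS]splitr lerD//.
  by rewrite -[leRHS](divfK (lt0r_neq0 M0)) ler_pM// ?hp ?hM.
by rewrite -[leRHS](divfK (lt0r_neq0 N0)) mulrC ler_pM// ?hN ?hq.
Qed.

Lemma poly_limitX f n : poly_limit f -> poly_limit (fun x => f x ^+ n).
Proof.
move=> lf; elim: n => [|n IH]; first exact: poly_limit_cst.
apply: (eq_poly_limit (f := fun x => f x * f x ^+ n)) => [x _|].
  by rewrite exprS.
exact: poly_limitM.
Qed.

Lemma expr_small w e : `|w| < 1 -> 0 < e -> exists n, `|w| ^+ n <= e.
Proof.
(* The modulus in [R[i]] becomes a real square root, to which the convergence of real geometric
   sequences applies. *)
rewrite normc_def; set r := Num.sqrt _.
case: e => [e e']; rewrite [1]/(1%:C)%C ltcR ltcE /= => r1 /andP[/eqP -> e0].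
have r0 : 0 <= r by rewrite sqrtr_ge0.
have /cvgr0_norm_le /(_ e e0) : (fun n => r ^+ n) @ \oo --> (0 : R).
  by apply: cvg_expr; rewrite ger0_norm.
move=> [n _ /(_ n (leqnn n))] /=; rewrite ger0_norm ?exprn_ge0// => h.
by exists n; rewrite -rmorphXn lecR.
Qed.

(* Geometric series: [1 / (1 - w u) = \sum_k w^k u^k], uniformly in [|u| <= 1] *)
Lemma poly_limitV w : `|w| < 1 -> poly_limit (fun x => (1 - w * u x)^-1).
Proof.
move=> w1 e e0; have w10 : 0 < 1 - `|w| by rewrite subr_gt0.
have [n hn] := expr_small w1 (mulr_gt0 e0 w10).
exists (\sum_(i < n) (w *: 'X) ^+ i) => x Dx.
have hl : 1 - `|w| <= `|1 - w * u x|.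
  rewrite (le_trans _ (lerB_dist _ _))// normr1 lerB// normrM ler_piMr//.
  exact: u_le1.
have h0 : 0 < `|1 - w * u x| by rewrite (lt_le_trans w10).
have nz : 1 - w * u x != 0 by rewrite -normr_gt0.
rewrite horner_sum.
under eq_bigr do rewrite horner_exp hornerZ hornerX.
rewrite (_ : _ - _ = (w * u x) ^+ n / (1 - w * u x)).
  rewrite normrM normfV ler_pdivrMr// normrX normrM exprMn.
  apply: (@le_trans _ _ (`|w| ^+ n)).
    by rewrite ler_piMr ?exprn_ge0// exprn_ile1// u_le1.
  by rewrite (le_trans hn)// ler_pM2l.
apply: (mulIf nz); rewrite mulrBl mulVf// divfK//.
rewrite [X in 1 - X](_ : _ = 1 - (w * u x) ^+ n); first by ring.
by apply: oppr_inj; rewrite [RHS]opprB subrX1 -mulrN opprB mulrC.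
Qed.

End UniformApproximation.

Section MeanValue.
Context {R : realType}.
Implicit Types (f g : R[i] -> R[i]).

Definition closed_disc : set R[i] := [set z | `|z| <= 1].

(* Continuous functions on the closed disc which are holomorphic inside it *)
Definition disc_algebra f := poly_limit closed_disc id f.

Lemma small_eq0 (M : R) (z : R[i]) :
  (forall e, 0 < e -> `|Re z| <= M * e /\ `|Im z| <= M * e) -> z = 0.
Proof.
move=> h.
have M0 : 0 <= M by have [/(le_trans (normr_ge0 _))] := h 1 ltr01; rewrite mulr1.
have L (x : R) : (forall e, 0 < e -> `|x| <= M * e) -> x = 0.
  move=> hx; apply/eqP; rewrite -normr_le0; apply/ler_addgt0Pl => e e0.
  (* Dividing by [M + 1] also covers [M = 0]. *)
  have M1 : 0 < M + 1 by rewrite ltr_wpDl.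
  rewrite addr0 (le_trans (hx _ (divr_gt0 e0 M1)))// mulrCA ler_piMr ?(ltW e0)//.
  by rewrite ler_pdivrMr// mul1r lerDl.
case: z h => a b h; congr (_ +i* _)%C; apply: L => e /h; by case.
Qed.

Lemma expi_in_disc t : closed_disc (expi t : R[i]).
Proof. by rewrite /closed_disc /= norm_expi. Qed.

Lemma integC_expiX n : integC circ (fun t => expi t ^+ n : R[i]).
Proof.
apply: (@integC_bounded _ _ _ _ _ 1); first by apply: mCX; exact: mC_expi.
by move=> t; rewrite normrX norm_expi expr1n.
Qed.

Lemma cint_horner_expi (p : {poly R[i]}) :
  integC circ (fun t => p.[expi t]) /\ cint circ (fun t => p.[expi t]) = p.[0].
Proof.
have E : (fun t : R => \sum_(i < size p) p`_i * expi t ^+ i) =1 (fun t => p.[expi t]).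
  by move=> t; rewrite horner_coef.
have [|i1 i2] := @cint_sum _ _ _ circ _ (index_enum 'I_(size p))
    (fun (i : 'I_(size p)) t => p`_i * expi t ^+ i).
  by move=> i; apply: integCZ; exact: integC_expiX.
rewrite -(funext E); split; first exact: i1.
rewrite i2 horner_coef; apply: eq_bigr => i _.
by rewrite cintZ ?cint_expi ?expr0n//; exact: integC_expiX.
Qed.

(** Exact for polynomials, where only the constant term has a nonzero mean. A uniform error e on the
    closed disc moves the mean and the value at the origin by at most e each, whence the constant
    2. *)
Lemma mean_value f : disc_algebra f -> mC (fun t : measurableTypeR R => f (expi t)) ->
  cint circ (fun t => f (expi t)) = f 0.
Proof.
move=> df mf; apply/eqP; rewrite -subr_eq0; apply/eqP.
apply: (small_eq0 (M := 2)) => e e0.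
have [|p hp] := df e%:C%C; first by rewrite ltcR.
have [ip cp] := cint_horner_expi p.
have hf t : `|f (expi t) - p.[expi t]| <= e%:C%C by exact/hp/expi_in_disc.
have h0 : `|f 0 - p.[0]| <= e%:C%C by apply: hp; rewrite /closed_disc/= normr0.
have mp : mC (fun t : measurableTypeR R => p.[expi t]).
  apply: (eq_mC (f := fun t : measurableTypeR R =>
      \sum_(i < size p) p`_i * expi t ^+ i)) => [t|].
    by rewrite horner_coef.
  apply: mC_sum => i; apply: mCM; first exact: mC_cst.
  by apply: mCX; exact: mC_expi.
have mfp := mCB mf mp.
have ifp : integC circ _ := integC_bounded _ mfp hf.
have iF : integC circ (fun t => f (expi t)).
  apply: (eq_integC (f := fun t : measurableTypeR R =>
      (f (expi t) - p.[expi t]) + p.[expi t])) => [t|].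
    by rewrite subrK.
  exact: integCD.
have := cint_le (mu := circ) mfp (integrable_cst_prob circ e) hf.
rewrite Rintegral_cst// (_ : _ setT = 1%E) ?mulr1; last exact: probability_setT.
rewrite cintB// cp => -[h1 h2]; have [h3 h4] := ReIm_le h0.
rewrite (_ : _ - f 0 = (cint circ (fun t => f (expi t)) - p.[0]) - (f 0 - p.[0]));
  last by ring.
split; [rewrite ReD|rewrite ImD]; rewrite (le_trans (ler_normD _ _))// mulr_natl mulr2n.
  by rewrite lerD//; move: h3; case: (_ - _) => ? ?; rewrite normrN.
by rewrite lerD//; move: h4; case: (_ - _) => ? ?; rewrite normrN.
Qed.

End MeanValue.

(** * Blaschke factors and kernels *)

Section ArcSystem.
Context {R : realType}.
Variables (xi0 c : R).
Hypotheses (xi0_gt0 : 0 < xi0) (xi0_lt_pi : xi0 < pi).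
Implicit Types (z : R[i]) (m n : int) (r : bool).

Definition arc_tan : R := tan ((pi - xi0) / 4).

(** This is [- kappa] and also the conjugate of [kappa]. Being purely imaginary, it is negated by
    conjugation, so on the circle conjugates of rational expressions in it are again rational. *)
Definition arc_pole : R[i] := 'i * arc_tan%:C%C.

Local Notation y := arc_pole.
Local Notation u := (expi c).

Lemma arc_angle : 0 < (pi - xi0) / 4 < pi / 4.
Proof. by apply/andP; split; move: xi0_gt0 xi0_lt_pi; lra. Qed.

Lemma cos_arc_gt0 : 0 < cos ((pi - xi0) / 4).
Proof.
by apply: cos_gt0_pihalf; have := arc_angle; have := pi_gt0 R; lra.
Qed.

Lemma arc_tan_gt0 : 0 < arc_tan.
Proof.
rewrite /arc_tan /tan divr_gt0 ?cos_arc_gt0//; apply: sin_gt0_pi.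
by have := arc_angle; have := pi_gt0 R; lra.
Qed.

(** With theta = (pi - xi0) / 4 one has xi0 / 2 = pi / 2 - 2 theta, so this is the double angle
    formula for cos(2 theta). *)
Lemma sin_half_xi0 : sin (xi0 / 2) =
  cos ((pi - xi0) / 4) ^+ 2 - sin ((pi - xi0) / 4) ^+ 2.
Proof.
have -> : xi0 / 2 = pi / 2 - ((pi - xi0) / 4 + (pi - xi0) / 4).
  by field.
by rewrite sinB sin_pihalf cos_pihalf mul1r mul0r subr0 cosD !expr2.
Qed.

Lemma sin_half_arc_tan : sin (xi0 / 2) = (1 - arc_tan ^+ 2) / (1 + arc_tan ^+ 2).
Proof.
have c0 := lt0r_neq0 cos_arc_gt0; have cs := cos2Dsin2 ((pi - xi0) / 4).
rewrite sin_half_xi0 /arc_tan /tan.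
set C := cos _ in c0 cs *; set S := sin _ in cs *.
have -> : 1 + (S / C) ^+ 2 = (C ^+ 2)^-1.
  have C2 : C ^+ 2 != 0 by rewrite expf_neq0.
  by apply: (mulIf C2); rewrite mulVf// mulrDl mul1r exprMn exprVn divfK.
by field.
Qed.

Lemma sin_half_bounds : 0 < sin (xi0 / 2) < 1.
Proof.
have h0 : 0 < sin (xi0 / 2).
  by apply: sin_gt0_pi; move: xi0_gt0 xi0_lt_pi; lra.
rewrite h0 /= sin_half_arc_tan ltr_pdivrMr ?mul1r.
  by have := exprn_gt0 2 arc_tan_gt0; lra.
by have := exprn_gt0 2 arc_tan_gt0; lra.
Qed.

(** Read off from [sin (xi0 / 2) = (1 - t^2) / (1 + t^2)] with t = [arc_tan]: the left side is
    positive. *)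
Lemma arc_tan_lt1 : arc_tan < 1.
Proof.
have /andP[] := sin_half_bounds; have t0 := arc_tan_gt0.
have t2 : 0 < 1 + arc_tan ^+ 2 by have := exprn_gt0 2 t0; lra.
rewrite sin_half_arc_tan pmulr_lgt0 ?invr_gt0// subr_gt0 => h _.
by rewrite -(@expr_lt1 _ 2)// ltW.
Qed.

Lemma arc_pole_conj : y^* = - y.
Proof.
have t0 : 0 <= arc_tan%:C%C :> R[i] by rewrite ler0c ltW// arc_tan_gt0.
by rewrite /y rmorphM/= conjCi (geC0_conj t0) mulNr.
Qed.

Lemma norm_arc_pole : `|y| = arc_tan%:C%C.
Proof.
by rewrite /y normrM normCi mul1r ger0_norm// ler0c ltW// arc_tan_gt0.
Qed.

Lemma norm_arc_pole_lt1 : `|y| < 1.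
Proof. by rewrite norm_arc_pole ltcR arc_tan_lt1. Qed.

Lemma kappaE : kappa xi0 = - y.
Proof. by rewrite /kappa /y mulNr. Qed.

Lemma kappa_conj : (kappa xi0)^* = y.
Proof. by rewrite kappaE rmorphN/= arc_pole_conj opprK. Qed.

(** The common normalizing constant of the kernels at [kappa] and at its conjugate, two points of
    equal modulus. *)
Definition arc_sigma : R[i] := sqrtC (1 - `|y| ^+ 2).
Local Notation sg := arc_sigma.

Lemma arc_sigma_sqr : sg ^+ 2 = 1 + y ^+ 2.
Proof. by rewrite sqrtCK normCK arc_pole_conj mulrN opprK. Qed.

Lemma arc_sigma_conj : sg^* = sg.
Proof.
rewrite geC0_conj// sqrtC_ge0 subr_ge0 exprn_ile1// ltW//.
exact: norm_arc_pole_lt1.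
Qed.

Lemma b_kappaE z : b_kappa xi0 z = 'i^-1 * ((z + y) / (1 - z * y)).
Proof. by rewrite /b_kappa kappa_conj kappaE opprK. Qed.

Lemma b_kappabarE z : b_kappabar xi0 z = 'i * ((z - y) / (1 + z * y)).
Proof. by rewrite /b_kappabar kappa_conj kappaE mulrN opprK. Qed.

Definition arc_blaschke z := b_kappa xi0 z * b_kappabar xi0 z.
Local Notation B := arc_blaschke.

Definition arc_kernel r z : R[i] :=
  if r then b_kappabar xi0 z * hardy_kernel (kappa xi0) z
  else hardy_kernel (kappa xi0)^* z * u.
#[global] Arguments arc_kernel : simpl never.
Local Notation E := arc_kernel.

Lemma arc_blaschkeE z : B z = (z + y) * (z - y) / ((1 - z * y) * (1 + z * y)).
Proof.
rewrite /arc_blaschke b_kappaE b_kappabarE invfM mulrACA mulVf ?neq0Ci// mul1r.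
by rewrite mulrACA.
Qed.

Lemma arc_kernel0E z : E false z = sg / (1 + z * y) * u.
Proof.
by rewrite /arc_kernel /hardy_kernel kappa_conj arc_pole_conj mulrN opprK.
Qed.

Lemma arc_kernel1E z : E true z =
  'i * ((z - y) / (1 + z * y)) * (sg / (1 - z * y)).
Proof.
by rewrite /arc_kernel /hardy_kernel b_kappabarE kappa_conj kappaE normrN.
Qed.

Section OnCircle.
Variable z : R[i].
Hypothesis z1 : `|z| = 1.

Lemma circle_neq0 : z != 0.
Proof. by rewrite -normr_eq0 z1 oner_eq0. Qed.

Lemma circle_conj : z^* = z^-1.
Proof. by rewrite invC_norm z1 expr1n invr1 mul1r. Qed.

Lemma circle_add_neq0 (w : R[i]) : `|w| < 1 -> z + w != 0.
Proof.
move=> w1; rewrite addr_eq0; apply: contraTneq w1 => zw.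
by rewrite -(normrN w) -zw z1 ltxx.
Qed.

Lemma circle_1add_neq0 (w : R[i]) : `|w| < 1 -> 1 + z * w != 0.
Proof.
move=> w1; rewrite addrC addr_eq0; apply: contraTneq w1 => zw.
by have := congr1 Num.norm zw; rewrite normrM z1 mul1r normrN1 => ->; rewrite ltxx.
Qed.

Lemma arc_neq0 : [/\ z + y != 0, z - y != 0, 1 - z * y != 0 & 1 + z * y != 0].
Proof.
have y1 := norm_arc_pole_lt1; have Ny1 : `|- y| < 1 by rewrite normrN.
split; [exact: circle_add_neq0|exact: circle_add_neq0| |exact: circle_1add_neq0].
by rewrite -mulrN; exact: circle_1add_neq0.
Qed.

Lemma arc_blaschke_neq0 : B z != 0.
Proof.
have [n1 n2 n3 n4] := arc_neq0.
by rewrite arc_blaschkeE !(mulf_eq0, invr_eq0) !negb_or n1 n2 n3 n4.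
Qed.

Lemma arc_blaschke_conj : (B z)^* = (B z)^-1.
Proof.
have [n1 n2 n3 n4] := arc_neq0; have n0 := circle_neq0.
(* Only [w^* = - w] is kept of the pole, now a variable; with [z^* = z^-1] the claim becomes a
   rational identity. *)
rewrite !arc_blaschkeE; move: (arc_pole_conj) n1 n2 n3 n4; move: y => w wJ n1 n2 n3 n4.
rewrite !(fmorphV, rmorphM, rmorphD, rmorphN, rmorph1)/= wJ circle_conj.
by field; rewrite n0 n1 n2 n3 n4.
Qed.

Lemma arc_kernel0_conj : (E false z)^* = sg * z / (z - y) * u^*.
Proof.
have [n1 n2 n3 n4] := arc_neq0; have n0 := circle_neq0.
rewrite arc_kernel0E rmorphM; congr (_ * _).
move: (arc_pole_conj) n1 n2 n3 n4 (arc_sigma_conj).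
move: y sg => w s wJ n1 n2 n3 n4 sJ.
rewrite !(fmorphV, rmorphM, rmorphD, rmorph1)/= wJ sJ circle_conj.
by field; rewrite n0 n2.
Qed.

Lemma arc_kernel1_conj : (E true z)^* =
  'i^-1 * ((1 + z * y) / (z - y)) * (sg * z / (z + y)).
Proof.
have [n1 n2 n3 n4] := arc_neq0; have n0 := circle_neq0.
rewrite arc_kernel1E; move: (arc_pole_conj) n1 n2 n3 n4 (arc_sigma_conj).
move: y sg => w s wJ n1 n2 n3 n4 sJ.
rewrite !(fmorphV, rmorphM, rmorphD, rmorphN, rmorph1)/= wJ sJ circle_conj conjCi invCi.
by field; rewrite n0 n1 n2.
Qed.

(** On the circle [b_kappabar] does not vanish, which splitting its power [m + 1] requires since [m]
    may be negative. *)
Lemma e_sysE m r : e_sys xi0 c (m * 2 + r%:Z) z = B z ^ m * E r z.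
Proof.
have [n1 n2 n3 n4] := arc_neq0.
have b20 : b_kappabar xi0 z != 0.
  by rewrite b_kappabarE !(mulf_eq0, invr_eq0) !negb_or neq0Ci n2 n4.
rewrite /e_sys /even_int /=.
have -> : (((m * 2 + r%:Z) %/ 2) = m)%Z.
  by rewrite divzMDl// divz_small ?addr0//; case: r.
have -> : (2 %| m * 2 + r%:Z)%Z = ~~ r.
  by rewrite rpredDl ?dvdz_mull//; case: r.
rewrite /arc_blaschke /arc_kernel; move: b20.
move: (b_kappabar xi0 z) (b_kappa xi0 z) => b2 b1 b20; rewrite expfzMl.
case: r => /=; last by rewrite !mulrA.
by rewrite expfzDr// expr1z !mulrA.
Qed.

End OnCircle.

End ArcSystem.

(** * Closure properties of the disc algebra *)

Section DiscAlgebra.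
Context {R : realType}.
Implicit Types (f g : R[i] -> R[i]) (w z : R[i]).

Let id_le1 z : closed_disc z -> `|id z| <= 1. Proof. by []. Qed.

Lemma norm_exprz1 z (n : int) : `|z| = 1 -> `|z ^ n| = 1.
Proof.
case: n => n z1; last rewrite -[_ ^ _]/(_ ^- _) normfV.
  by rewrite -exprnP normrX z1 expr1n.
by rewrite normrX z1 expr1n invr1.
Qed.

Lemma eq_disc_algebra f g : f =1 g -> disc_algebra f -> disc_algebra g.
Proof. by move=> fg; apply: eq_poly_limit => z _. Qed.

Lemma disc_algebraM f g : disc_algebra f -> disc_algebra g ->
  disc_algebra (fun z => f z * g z).
Proof. exact: (poly_limitM id_le1). Qed.

Lemma disc_algebraD f g : disc_algebra f -> disc_algebra g ->
  disc_algebra (fun z => f z + g z).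
Proof. exact: poly_limitD. Qed.

Lemma disc_algebraX f n : disc_algebra f -> disc_algebra (fun z => f z ^+ n).
Proof. exact: (poly_limitX id_le1). Qed.

Lemma disc_algebra_cst w : disc_algebra (fun=> w).
Proof. exact: poly_limit_cst. Qed.

Lemma disc_algebra_id : disc_algebra (id : R[i] -> R[i]).
Proof. exact: poly_limit_id. Qed.

Lemma disc_algebraV w : `|w| < 1 -> disc_algebra (fun z => (1 + z * w)^-1).
Proof.
move=> w1; apply: (eq_disc_algebra (f := fun z => (1 - (- w) * z)^-1)) => [z|].
  by rewrite mulNr opprK mulrC.
by apply: (poly_limitV id_le1); rewrite normrN.
Qed.

Lemma disc_algebra_bounded f : disc_algebra f ->
  exists M : R, forall t, `|f (expi t)| <= M%:C%C.
Proof.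
move=> /(poly_limit_bounded id_le1) [[M M']].
rewrite ltcE /= => /andP[/eqP -> _] hM; exists M => t.
exact/hM/expi_in_disc.
Qed.

End DiscAlgebra.

(** * The system on the circle: regularity and pairwise products *)

Section ArcOrthonormal.
Context {R : realType}.
Variables (xi0 c : R).
Hypotheses (xi0_gt0 : 0 < xi0) (xi0_lt_pi : xi0 < pi).
Implicit Types (z : R[i]) (m n : int) (r : bool).

Local Notation y := (arc_pole xi0).
Local Notation u := (expi c).
Local Notation sg := (arc_sigma xi0).
Local Notation B := (arc_blaschke xi0).
Local Notation E := (arc_kernel xi0 c).

(** The cofactor C_r in [B conj(E_r) = z C_r] on the circle. Its poles lie outside the closed disc,
    so it belongs to the disc algebra. *)
Definition arc_dual r z : R[i] :=
  if r then 'i^-1 * sg / (1 - z * y)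
  else sg * (z + y) / ((1 - z * y) * (1 + z * y)) * u^*.
#[global] Arguments arc_dual : simpl never.
Local Notation C := arc_dual.

Lemma arc_dualE r z : `|z| = 1 -> B z * (E r z)^* = z * C r z.
Proof.
move=> z1; have [n1 n2 n3 n4] := arc_neq0 xi0_gt0 xi0_lt_pi z1.
have n0 := circle_neq0 z1.
case: r; rewrite arc_blaschkeE ?arc_kernel1_conj ?arc_kernel0_conj// /arc_dual.
  by field; rewrite n1 n2 n3 n4 neq0Ci.
by field; rewrite n2 n3 n4.
Qed.

Let y1 : `|y| < 1 := norm_arc_pole_lt1 xi0_gt0 xi0_lt_pi.

Lemma disc_algebraVN : disc_algebra (fun z => (1 - z * y)^-1).
Proof.
apply: (eq_disc_algebra (f := fun z => (1 + z * - y)^-1)) => [z|].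
  by rewrite mulrN.
by apply: disc_algebraV; rewrite normrN.
Qed.

Let dV := disc_algebraV y1.
Let dVN := disc_algebraVN.
Let dW := @disc_algebra_cst R.
Let dI := @disc_algebra_id R.

Lemma disc_algebra_blaschke : disc_algebra B.
Proof.
apply: (eq_disc_algebra (f := fun z => ((z + y) * (z + - y)) *
    ((1 - z * y)^-1 * (1 + z * y)^-1))) => [z|].
  by rewrite arc_blaschkeE// invfM.
by do 2?apply: disc_algebraM => //; apply: disc_algebraD.
Qed.

Lemma disc_algebra_kernel r : disc_algebra (E r).
Proof.
case: r.
  apply: (eq_disc_algebra (f := fun z => 'i * ((z + - y) * (1 + z * y)^-1) *
      (sg * (1 - z * y)^-1))) => [z|]; first by rewrite arc_kernel1E.
  by do 3?apply: disc_algebraM => //; apply: disc_algebraD.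
apply: (eq_disc_algebra (f := fun z => sg * (1 + z * y)^-1 * u)) => [z|].
  by rewrite arc_kernel0E.
by do 2?apply: disc_algebraM.
Qed.

Lemma disc_algebra_dual r : disc_algebra (C r).
Proof.
case: r; first by rewrite /arc_dual; do 2?apply: disc_algebraM.
apply: (eq_disc_algebra (f := fun z => sg * (z + y) *
  ((1 - z * y)^-1 * (1 + z * y)^-1) * u^*)) => [z|].
  by rewrite -invfM.
by do 3?apply: disc_algebraM => //; apply: disc_algebraD.
Qed.

Lemma int_doubleP n : exists m r, n = m * 2 + r%:Z.
Proof.
exists (n %/ 2)%Z, ((n %% 2)%Z == 1).
rewrite {1}(divz_eq n 2); congr (_ + _).
have := modz_ge0 n (isT : (2 : int) != 0); have := ltz_pmod n (isT : 0 < (2 : int)).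
by case: (n %% 2)%Z => [[|[|k]]|k].
Qed.

Lemma norm_blaschke_expi t : `|B (expi t)| = 1.
Proof.
have := arc_blaschke_conj xi0_gt0 xi0_lt_pi (norm_expi t) => bJ.
apply/eqP; rewrite -(@pexpr_eq1 _ _ 2)// normCK bJ mulfV//.
exact: arc_blaschke_neq0 (norm_expi t).
Qed.

Let mE : mC (@expi R : measurableTypeR R -> R[i]) := mC_expi.

Lemma mC_blaschke_expi : mC (fun t : measurableTypeR R => B (expi t)).
Proof.
apply: (eq_mC (f := fun t : measurableTypeR R => (expi t + y) * (expi t - y) /
    ((1 - expi t * y) * (1 + expi t * y)))) => [t|].
  by rewrite arc_blaschkeE.
have mW := @mC_cst _ (measurableTypeR R) R.
by apply: mCM; [|apply: mCV]; apply: mCM; repeat (apply: mCD || apply: mCN || apply: mCM).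
Qed.

Lemma mC_kernel_expi r : mC (fun t : measurableTypeR R => E r (expi t)).
Proof.
have mW := @mC_cst _ (measurableTypeR R) R.
case: r.
  apply: (eq_mC (f := fun t : measurableTypeR R =>
     'i * ((expi t - y) / (1 + expi t * y)) * (sg / (1 - expi t * y)))) => [t|].
    by rewrite arc_kernel1E.
  by repeat (apply: mCD || apply: mCN || apply: mCM || apply: mCV).
apply: (eq_mC (f := fun t : measurableTypeR R => sg / (1 + expi t * y) * u)) => [t|].
  by rewrite arc_kernel0E.
by repeat (apply: mCD || apply: mCN || apply: mCM || apply: mCV).
Qed.

Lemma e_sys_expiE m r t :
  e_sys xi0 c (m * 2 + r%:Z) (expi t) = B (expi t) ^ m * E r (expi t).
Proof. by rewrite e_sysE// norm_expi. Qed.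

Lemma mC_e_sys n : mC (fun t : measurableTypeR R => e_sys xi0 c n (expi t)).
Proof.
have [m [r ->]] := int_doubleP n.
apply: (eq_mC (f := fun t : measurableTypeR R => B (expi t) ^ m * E r (expi t))) => [t|].
  by rewrite e_sys_expiE.
apply: mCM; last exact: mC_kernel_expi.
by apply: mCXz; exact: mC_blaschke_expi.
Qed.

Lemma e_sys_bounded n : exists M : R, forall t, `|e_sys xi0 c n (expi t)| <= M%:C%C.
Proof.
have [m [r ->]] := int_doubleP n.
have [M hM] := disc_algebra_bounded (disc_algebra_kernel r); exists M => t.
by rewrite e_sys_expiE normrM norm_exprz1 ?mul1r// norm_blaschke_expi.
Qed.

Lemma sqint_e_sys n : sqint circ (fun t => e_sys xi0 c n (expi t)).
Proof.
have [M hM] := e_sys_bounded n.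
by apply: (@sqint_bounded _ _ _ circ _ M); [exact: mC_e_sys|exact: hM].
Qed.

Lemma L2_e_sys n : L2 (e_sys xi0 c n).
Proof. by apply/L2P; exact: sqint_e_sys. Qed.

(** If [m' < m], write m - m' = j + 1: one factor [B] turns conj(E_r') into z C_r', and B^j E_r
    stays in the disc algebra. If [m = m'], only the pair r = 1, r' = 0 is left. *)
Lemma e_sys_mulJ n n' : n' < n -> exists2 G : R[i] -> R[i], disc_algebra G &
  forall t, e_sys xi0 c n (expi t) * (e_sys xi0 c n' (expi t))^* =
    expi t * G (expi t).
Proof.
have [m [r ->]] := int_doubleP n; have [m' [r' ->]] := int_doubleP n' => lt_n.
have [mm|mm] := ltP m' m.
  have [j jE] : exists j : nat, m - m' = j.+1%:Z.
    by exists (absz (m - m' - 1)%R); lia.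
  exists (fun z => B z ^+ j * E r z * C r' z) => [|t].
    do 2?apply: disc_algebraM; [|exact: disc_algebra_kernel|exact: disc_algebra_dual].
    by apply: disc_algebraX; exact: disc_algebra_blaschke.
  have B0 : B (expi t) != 0 by apply: arc_blaschke_neq0 => //; exact: norm_expi.
  rewrite [RHS]mulrCA -(arc_dualE r' (norm_expi t)) !e_sys_expiE rmorphM/=.
  rewrite fmorphXz/= arc_blaschke_conj ?norm_expi// exprz_inv.
  rewrite [LHS](_ : _ = B (expi t) ^ (m - m') * (E r (expi t) * (E r' (expi t))^*)).
    by rewrite jE -exprnP exprS; ring.
  by rewrite expfzDr//; ring.
have mE' : m = m' by case: r r' lt_n => -[] /=; lia.
move: lt_n; rewrite mE'; case: r r' => -[] /=; try lia; move=> _.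
(* The factor [z - y] of E_1 cancels the denominator of conj(E_0) = sg z conj(u) / (z - y). *)
exists (fun z => 'i * sg ^+ 2 * u^* * ((1 + z * y)^-1 * (1 - z * y)^-1)) => [|t].
  by do 3?apply: disc_algebraM => //.
have t1 := norm_expi t.
have [n1 n2 n3 n4] := arc_neq0 xi0_gt0 xi0_lt_pi t1.
have -> : (m' * 2 + 1)%R = m' * 2 + true%:Z by [].
have -> : (m' * 2 + 0%N%:Z)%R = m' * 2 + false%:Z by [].
rewrite !e_sys_expiE rmorphM/= fmorphXz/= arc_blaschke_conj// exprz_inv mulrACA.
rewrite -expfzDr ?arc_blaschke_neq0// ?subrr expr0z mul1r.
rewrite arc_kernel0_conj// arc_kernel1E//.
by field; rewrite n2 n3 n4.
Qed.

End ArcOrthonormal.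

(** * Orthonormality *)

Section HardySpace.
Context {R : realType}.
Implicit Types (f G : R[i] -> R[i]).

Lemma conj_expiXN (j : nat) (t : R) :
  (expi t ^ - (j.+1)%:Z)^* = expi t ^+ j.+1 :> R[i].
Proof.
by rewrite fmorphXz/= conj_expi exprz_inv opprK.
Qed.

(** The coefficient of index -(j+1) is the mean of f z^(j+1), a disc algebra function vanishing at
    the origin. *)
Lemma H2_disc_algebra f : disc_algebra f -> L2 f -> H2 f.
Proof.
move=> df lf; split=> // -[//|j] _; rewrite NegzE dotCE.
under eq_fun do rewrite conj_expiXN.
have [mf _] := (L2P f).1 lf.
rewrite (mean_value (f := fun z => f z * z ^+ j.+1)) ?expr0n ?mulr0//.
  apply: disc_algebraM => //; apply: disc_algebraX; exact: disc_algebra_id.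
by apply: mCM => //; apply: mCX; exact: mC_expi.
Qed.

(** For a polynomial [p] in place of [G] the integral is a combination of Fourier coefficients of
    [f] with negative index. A uniform approximation of [G] by polynomials then gives the general
    case. *)
Lemma H2_orth f G : H2 f -> disc_algebra G ->
  mC (fun t : measurableTypeR R => G (expi t)) ->
  cint circ (fun t => f (expi t) * (expi t * G (expi t))) = 0.
Proof.
move=> [lf hf] dG mG; have [mf sf] := (L2P f).1 lf.
have mx : mC (expi : measurableTypeR R -> R[i]) := mC_expi.
have mfx : mC (fun t : measurableTypeR R => f (expi t) * expi t) by exact: mCM.
(* An integrable majorant of |f|, since |f| <= 1 + |f|^2; it takes the place of the Cauchy-Schwarz
   inequality. *)
pose b (t : measurableTypeR R) := 1 + nsq (f (expi t)).
have ib : circ.-integrable setT (EFin \o b).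
  rewrite (_ : _ \o _ = (fun t => 1%:E + (nsq (f (expi t)))%:E)%E)//.
  by apply: integrableD => //; exact: (integrable_cst_prob circ).
have fb (t : measurableTypeR R) : `|f (expi t)| <= (b t)%:C%C.
  have n0 := nsq_ge0 (f (expi t)).
  have b0 : (0 : R[i]) <= (b t)%:C%C by rewrite ler0c addr_ge0.
  rewrite -[leRHS]ger0_norm// -nsq_le nsq_real /b.
  by rewrite -subr_ge0; move: (nsq _) n0 => a a0; nra.
have orth (p : {poly R[i]}) :
    integC circ (fun t => f (expi t) * (expi t * p.[expi t])) /\
    cint circ (fun t => f (expi t) * (expi t * p.[expi t])) = 0.
  have E : (fun t : measurableTypeR R =>
      \sum_(i < size p) p`_i * (f (expi t) * (expi t ^- i.+1)^*)) =
      (fun t => f (expi t) * (expi t * p.[expi t])).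
    apply/funext => t; rewrite horner_coef !mulr_sumr; apply: eq_bigr => i _.
    by rewrite fmorphV/= rmorphXn/= conj_expi exprVn invrK exprS; ring.
  have si (i : nat) : integC circ (fun t => f (expi t) * (expi t ^- i.+1)^*).
    apply: sqint_mulJ => //; apply: (@sqint_bounded _ _ _ _ _ 1).
      by apply: mCV; exact: mCX.
    by move=> t; rewrite normfV normrX norm_expi expr1n invr1.
  have [|i1 i2] := @cint_sum _ _ _ circ _ (index_enum 'I_(size p))
      (fun (i : 'I_(size p)) t => p`_i * (f (expi t) * (expi t ^- i.+1)^*)).
    by move=> i; exact: integCZ.
  rewrite -E; split; first exact: i1.
  rewrite i2 big1// => i _; rewrite cintZ//.
  suff -> : cint circ (fun t => f (expi t) * (expi t ^- i.+1)^*) = 0 by rewrite mulr0.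
  (* [Negz i] is the exponent -(i+1), and [z ^ Negz i] unfolds to [z ^- i.+1]. *)
  exact: (hf (Negz i) isT).
apply: (small_eq0 (M := \int[circ]_t b t)) => e e0.
have [|p hp] := dG e%:C%C; first by rewrite ltcR.
have [ip cp] := orth p.
pose h (t : measurableTypeR R) := f (expi t) * expi t * (G (expi t) - p.[expi t]).
have mh : mC h.
  apply: mCM => //; apply: mCB => //.
  apply: (eq_mC (f := fun t : measurableTypeR R =>
      \sum_(i < size p) p`_i * expi t ^+ i)) => [t|].
    by rewrite horner_coef.
  by apply: mC_sum => i; apply: mCM; [exact: mC_cst|exact: mCX].
have ieb : circ.-integrable setT (EFin \o (fun t => e * b t)).
  rewrite (_ : _ \o _ = (fun t => e%:E * (b t)%:E)%E)//; exact: integrableZl.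
have hb t : `|h t| <= (e * b t)%:C%C.
  rewrite /h normrM normrM norm_expi mulr1 rmorphM/= mulrC.
  by apply: ler_pM => //; apply: hp; exact: expi_in_disc.
have := cint_le mh ieb hb; rewrite RintegralZl// mulrC.
suff -> : cint circ (fun t => f (expi t) * (expi t * G (expi t))) = cint circ h by [].
have ih := integC_le mh ieb hb.
rewrite -[RHS]addr0 -cp -cintD//; apply: eq_cint_circ => t; rewrite /h; ring.
Qed.

End HardySpace.

(** * Inner products of the system, and its position relative to [H2] *)

Section ArcBasis.
Context {R : realType}.
Variables (xi0 c : R).
Hypotheses (xi0_gt0 : 0 < xi0) (xi0_lt_pi : xi0 < pi).
Implicit Types (z : R[i]) (m n : int) (r : bool).

Local Notation y := (arc_pole xi0).
Local Notation u := (expi c).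
Local Notation sg := (arc_sigma xi0).
Local Notation B := (arc_blaschke xi0).
Local Notation E := (arc_kernel xi0 c).
Local Notation C := (arc_dual xi0 c).

Lemma dotC_e_sys_gt n n' : n' < n -> dotC (e_sys xi0 c n) (e_sys xi0 c n') = 0.
Proof.
move=> /(e_sys_mulJ c xi0_gt0 xi0_lt_pi)[G dG hG].
rewrite dotCE (eq_cint_circ hG) (mean_value (f := fun z => z * G z)) ?mul0r//.
  by apply: disc_algebraM => //; exact: disc_algebra_id.
rewrite -(funext hG); apply: mCM; first exact: mC_e_sys.
by apply: mCJ; exact: mC_e_sys.
Qed.

(* [|E_r|^2] is the Poisson kernel [1 / (1 - z w) + conj (1 / (1 - z w)) - 1]. *)
Lemma normsq_arc_kernel r : exists2 w : R[i], `|w| < 1 & forall z, `|z| = 1 ->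
  E r z * (E r z)^* = (1 + z * w)^-1 + ((1 + z * w)^-1)^* - 1.
Proof.
have y1 := norm_arc_pole_lt1 xi0_gt0 xi0_lt_pi.
have yJ := arc_pole_conj xi0_gt0 xi0_lt_pi.
have sE := arc_sigma_sqr xi0_gt0 xi0_lt_pi.
have cj w z : `|z| = 1 -> ((1 + z * w)^-1)^* = (1 + w^* / z)^-1.
  by move=> z1; rewrite fmorphV rmorphD rmorphM rmorph1/= (circle_conj z1) mulrC.
exists (if r then - y else y) => [|z z1]; first by case: r; rewrite ?normrN.
have [n1 n2 n3 n4] := arc_neq0 xi0_gt0 xi0_lt_pi z1.
have n0 := circle_neq0 z1.
rewrite cj//; case: r.
  rewrite rmorphN/= yJ opprK arc_kernel1_conj// arc_kernel1E//.
  rewrite [LHS](_ : _ = sg ^+ 2 * z / ((z + y) * (1 - z * y))); last first.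
    by field; rewrite n1 n2 n3 n4 neq0Ci.
  by rewrite sE; field; rewrite n0 n1 mulrN n3.
rewrite yJ arc_kernel0_conj// arc_kernel0E//.
rewrite [LHS](_ : _ = u * u^* * (sg ^+ 2 * z / ((z - y) * (1 + z * y)))); last first.
  by field; rewrite n2 n4.
rewrite -normCK norm_expi expr1n mul1r sE.
by field; rewrite n0 n2 n4.
Qed.

(** [B] is unimodular, so the integrand is |E_r|^2 = P + conj(P) - 1 with [P] in the disc algebra
    and P(0) = 1; its mean is 1 + 1 - 1. *)
Lemma dotC_e_sys_refl n : dotC (e_sys xi0 c n) (e_sys xi0 c n) = 1.
Proof.
have [m [r ->]] := int_doubleP n; have [w w1 hw] := normsq_arc_kernel r.
pose P z := (1 + z * w)^-1.
have mP : mC (fun t : measurableTypeR R => P (expi t)).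
  apply: mCV; apply: mCD; first exact: mC_cst.
  by apply: mCM; [exact: mC_expi|exact: mC_cst].
have dP : disc_algebra P by exact: disc_algebraV.
have [M hM] := disc_algebra_bounded dP.
have iP := integC_bounded circ mP hM.
have iPJ : integC circ (fun t => (P (expi t))^*).
  by apply: (integC_bounded circ (mCJ mP)) => t; rewrite norm_conjC.
rewrite dotCE (eq_cint_circ (k := fun t => (P (expi t) + (P (expi t))^*) - 1)).
  rewrite cintB//; [|exact: integCD|exact: integC_cst].
  rewrite cintD// cint_cst cintJ// mean_value// /P mul0r addr0 invr1 conjC1.
  by rewrite addrK.
move=> t; rewrite e_sys_expiE// rmorphM/= mulrACA -normCK.
by rewrite norm_exprz1 ?norm_blaschke_expi// expr1n mul1r hw// norm_expi.
Qed.

Lemma dotC_conj f g : L2 f -> L2 g -> dotC g f = (dotC f g)^* :> R[i].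
Proof.
move=> /L2P sf /L2P sg; rewrite !dotCE -cintJ; last exact: sqint_mulJ.
by apply: eq_cint_circ => t; rewrite rmorphM/= conjCK mulrC.
Qed.

Lemma dotC_e_sys n n' : dotC (e_sys xi0 c n) (e_sys xi0 c n') = (n == n')%:R.
Proof.
have [nn|nn|->] := ltgtP n n'; last by rewrite dotC_e_sys_refl.
  rewrite (dotC_conj (L2_e_sys c xi0_gt0 xi0_lt_pi n') (L2_e_sys c xi0_gt0 xi0_lt_pi n)).
  by rewrite dotC_e_sys_gt// conjC0.
exact: dotC_e_sys_gt.
Qed.

Lemma eq_dotC f f' g : (forall t, f (expi t) = f' (expi t)) ->
  dotC f g = dotC f' g :> R[i].
Proof. by move=> ff; rewrite !dotCE; apply: eq_cint_circ => t; rewrite ff. Qed.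

(** For n >= 0 the exponent [m] is a natural number, so B^k E_r is in the disc algebra; it agrees
    with the system on the circle, the only place where [L2] and [dotC] look. *)
Lemma H2_e_sys (n : nat) : H2 (e_sys xi0 c n).
Proof.
split; first exact: L2_e_sys.
have [m [r nE]] := int_doubleP n; have [k mk] : exists k : nat, m = k.
  by exists (absz m); case: r nE; lia.
pose f z := B z ^+ k * E r z.
have fE t : e_sys xi0 c n (expi t) = f (expi t) by rewrite nE e_sys_expiE// mk.
have [_ h] : H2 f.
  apply: H2_disc_algebra.
    apply: disc_algebraM; last exact: disc_algebra_kernel.
    by apply: disc_algebraX; exact: disc_algebra_blaschke.
  by apply/L2P; apply: eq_sqint (sqint_e_sys c xi0_gt0 xi0_lt_pi n).
by move=> j j0; rewrite (eq_dotC _ fE) h.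
Qed.

(** For n < 0 one has m = -(k+1), and the conjugate of e_n on the circle is B^(k+1) conj(E_r) = z
    B^k C_r, to which [H2_orth] applies. *)
Lemma dotC_H2_e_sys f n : H2 f -> n < 0 -> dotC f (e_sys xi0 c n) = 0.
Proof.
have [m [r ->]] := int_doubleP n => hf n0.
have [k mk] : exists k : nat, m = - k.+1%:Z.
  by exists (absz m).-1; case: r n0; lia.
pose G z := B z ^+ k * C r z.
have eE t : (e_sys xi0 c (m * 2 + r%:Z) (expi t))^* = expi t * G (expi t).
  rewrite e_sys_expiE// rmorphM fmorphXz/=.
  rewrite arc_blaschke_conj ?norm_expi// exprz_inv mk opprK -exprnP exprS.
  by rewrite -mulrA mulrCA arc_dualE ?norm_expi// /G; ring.
rewrite dotCE; under eq_cint_circ do rewrite eE.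
apply: H2_orth => //.
  apply: disc_algebraM; last exact: disc_algebra_dual.
  by apply: disc_algebraX; exact: disc_algebra_blaschke.
apply: (eq_mC (f := fun t : measurableTypeR R =>
    (expi t)^-1 * (e_sys xi0 c (m * 2 + r%:Z) (expi t))^*)) => [t|].
  by rewrite eE mulKf// expi_neq0.
apply: mCM; first by apply: mCV; exact: mC_expi.
by apply: mCJ; exact: mC_e_sys.
Qed.

End ArcBasis.

(** * The closed span of a family in L^2 *)

Section SquareIntegrableClosure.
Context {d} {T : measurableType d} {R : realType} {I : eqType}.
Variables (mu : probability T R) (e : I -> T -> R[i]).
Hypothesis sqint_e : forall i, sqint mu (e i).
Implicit Types (f g h : T -> R[i]).

Definition in_span g := exists (s : seq I) (l : I -> R[i]),
  uniq s /\ forall t, g t = \sum_(i <- s) l i * e i t.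

(** The closure of the span in L^2, phrased with the squared distance so that no square root
    appears. *)
Definition in_closure h := sqint mu h /\ forall eps : R, 0 < eps ->
  exists2 g, in_span g & \int[mu]_t nsq (h t - g t) < eps.

Lemma in_span_basis i : in_span (e i).
Proof. by exists [:: i], (fun=> 1); split=> // t; rewrite big_seq1 mul1r. Qed.

Lemma in_spanZ z f : in_span f -> in_span (fun t => z * f t).
Proof.
move=> [s [l [us fE]]]; exists s, (fun i => z * l i); split=> // t.
by rewrite fE mulr_sumr; apply: eq_bigr => i _; rewrite mulrA.
Qed.

Lemma in_spanD f g : in_span f -> in_span g -> in_span (fun t => f t + g t).
Proof.
move=> [s [l [us fE]]] [s' [l' [us' gE]]].
pose s2 := undup (s ++ s').
exists s2, (fun i => (if i \in s then l i else 0) + (if i \in s' then l' i else 0)).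
split=> [|t]; first exact: undup_uniq.
(* Both coefficient families are extended by zero to the common index list [s2], over which the two
   sums can be added termwise. *)
have L (r : seq I) (k : I -> R[i]) : uniq r -> {subset r <= s2} ->
    \sum_(i <- r) k i * e i t = \sum_(i <- s2) (if i \in r then k i else 0) * e i t.
  move=> ur rs.
  rewrite [RHS](eq_bigr (fun i => if i \in r then k i * e i t else 0)); last first.
    by move=> i _; case: ifP; rewrite ?mul0r.
  rewrite -big_mkcond -big_filter; apply: perm_big; apply: uniq_perm => //.
    by rewrite filter_uniq// undup_uniq.
  move=> i; rewrite mem_filter andb_idr//; exact: rs.
rewrite fE gE (L s)// ?(L s')//.
- by rewrite -big_split; apply: eq_bigr => i _ /=; rewrite mulrDl.
- by move=> i; rewrite mem_undup mem_cat => ->; rewrite orbT.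
- by move=> i; rewrite mem_undup mem_cat => ->.
Qed.

Lemma in_span_sum J (s : seq J) (F : J -> T -> R[i]) :
  (forall j, in_span (F j)) -> in_span (fun t => \sum_(j <- s) F j t).
Proof.
move=> cF; elim: s => [|j s IH].
  by exists [::], (fun=> 0); split=> // t; rewrite !big_nil.
have -> : (fun t => \sum_(j <- j :: s) F j t) = fun t => F j t + \sum_(j <- s) F j t.
  by apply/funext => t; rewrite big_cons.
exact: in_spanD.
Qed.

Lemma in_span_sqint f : in_span f -> sqint mu f.
Proof.
move=> [s [l [_ fE]]]; rewrite (funext fE); apply: sqint_sum => i.
exact: sqintZ.
Qed.

Lemma Rintegral_nsq_ge0 f : 0 <= \int[mu]_t nsq (f t).
Proof. by apply: Rintegral_ge0 => t _; exact: nsq_ge0. Qed.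

(** A substitute for the triangle inequality, in terms of squared norms. Its factors 2 are why
    errors below are split into two parts of size eps / 4. *)
Lemma Rintegral_nsqD_le f g : sqint mu f -> sqint mu g ->
  \int[mu]_t nsq (f t + g t) <=
  2 * (\int[mu]_t nsq (f t)) + 2 * (\int[mu]_t nsq (g t)).
Proof.
move=> sf sg; have [_ i1] := sf; have [_ i2] := sg; have [_ i3] := sqintD sf sg.
have j1 : mu.-integrable setT (EFin \o (fun t => 2 * nsq (f t))).
  rewrite (_ : _ \o _ = (fun t => 2%:E * (nsq (f t))%:E)%E)//; exact: integrableZl.
have j2 : mu.-integrable setT (EFin \o (fun t => 2 * nsq (g t))).
  rewrite (_ : _ \o _ = (fun t => 2%:E * (nsq (g t))%:E)%E)//; exact: integrableZl.
rewrite -!RintegralZl// -RintegralD//; apply: le_Rintegral => //.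
  rewrite (_ : _ \o _ = (fun t => (2 * nsq (f t))%:E + (2 * nsq (g t))%:E)%E)//.
  exact: integrableD.
by move=> t _; exact: nsqD_le.
Qed.

Lemma in_closureS f : in_span f -> in_closure f.
Proof.
move=> sf; split; first exact: in_span_sqint.
move=> eps eps0; exists f => //; under eq_Rintegral do rewrite subrr.
by rewrite Rintegral_cst// /nsq /= expr0n addr0 mul0r.
Qed.

Lemma in_closureD f g : in_closure f -> in_closure g ->
  in_closure (fun t => f t + g t).
Proof.
move=> [sf cf] [sg cg]; split; first exact: sqintD.
move=> eps eps0; have e4 : 0 < eps / 4 by rewrite divr_gt0.
have [f' sf' hf] := cf _ e4; have [g' sg' hg] := cg _ e4.
exists (fun t => f' t + g' t); first exact: in_spanD.
under eq_Rintegral do rewrite opprD addrACA.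
have := Rintegral_nsqD_le (sqintB sf (in_span_sqint sf')) (sqintB sg (in_span_sqint sg')).
by move=> /le_lt_trans; apply; lra.
Qed.

Lemma in_closureZ z f : in_closure f -> in_closure (fun t => z * f t).
Proof.
move=> [sf cf]; split; first exact: sqintZ.
move=> eps eps0.
(* The error scales by [nsq z]; the added 1 allows the division when z = 0. *)
have z1 : 0 < nsq z + 1 by rewrite ltr_wpDl// nsq_ge0.
have [g sg hg] := cf _ (divr_gt0 eps0 z1).
exists (fun t => z * g t); first exact: in_spanZ.
under eq_Rintegral do rewrite -mulrBr nsqM.
have [_ ig] := sqintB sf (in_span_sqint sg).
rewrite RintegralZl//.
rewrite ltr_pdivlMr// in hg.
have := Rintegral_nsq_ge0 (fun t => f t - g t); nra.
Qed.

Lemma in_closure_sum J (s : seq J) (F : J -> T -> R[i]) :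
  in_closure (fun=> 0) -> (forall j, in_closure (F j)) ->
  in_closure (fun t => \sum_(j <- s) F j t).
Proof.
move=> c0 cF; elim: s => [|j s IH].
  by rewrite (_ : (fun _ => _) = fun=> 0)//; apply/funext => t; rewrite big_nil.
rewrite (_ : (fun _ => _) = fun t => F j t + \sum_(j <- s) F j t).
  exact: in_closureD.
by apply/funext => t; rewrite big_cons.
Qed.

Lemma in_closure_limit h : sqint mu h -> (forall eps : R, 0 < eps ->
    exists2 f, in_closure f & \int[mu]_t nsq (h t - f t) < eps) ->
  in_closure h.
Proof.
move=> sh ch; split=> // eps eps0; have e4 : 0 < eps / 4 by rewrite divr_gt0.
have [f [sf cf] hf] := ch _ e4; have [g sg hg] := cf _ e4.
exists g => //.
have := Rintegral_nsqD_le (sqintB sh sf) (sqintB sf (in_span_sqint sg)).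
under eq_Rintegral do rewrite addrA subrK.
by move=> /le_lt_trans; apply; lra.
Qed.

Lemma in_closure_uniform h : mC h -> (forall eps : R, 0 < eps ->
    exists2 f, in_closure f & forall t, `|h t - f t| <= eps%:C%C) ->
  in_closure h.
Proof.
move=> mh ch; have [f1 [sf1 _] hf1] := ch 1 ltr01.
have sh : sqint mu h.
  rewrite (_ : h = fun t => f1 t + (h t - f1 t)).
    apply: sqintD => //; apply: (sqint_bounded mu _ hf1).
    by apply: mCB => //; case: sf1.
  by apply/funext => t; rewrite addrC subrK.
apply: in_closure_limit => // eps eps0.
(* Since e' <= 1, the squared uniform error is at most e'^2 <= e' <= eps / 2, and integrating
   against a probability keeps this bound. *)
pose e' := Num.min 1 (eps / 2).
have e0 : 0 < e' by rewrite /e' lt_min ltr01 divr_gt0.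
have [f cf hf] := ch e' e0; exists f => //.
apply: (@le_lt_trans _ _ (eps / 2)); last by lra.
have -> : eps / 2 = \int[mu]_t (cst (eps / 2) t).
  by rewrite Rintegral_cst// (_ : _ setT = 1%E) ?mulr1//; exact: probability_setT.
have [sf _] := cf; have [_ i1] := sqintB sh sf.
apply: le_Rintegral => //; first exact: integrable_cst_prob.
have e1 : (0 : R[i]) <= e'%:C%C by rewrite ler0c ltW.
move=> t _ /=; have := hf t; rewrite -[leRHS]ger0_norm//.
rewrite -nsq_le nsq_real => /le_trans; apply.
have h1 : e' <= 1 by rewrite /e' ge_min lexx.
have h2 : e' <= eps / 2 by rewrite /e' ge_min lexx orbT.
by nra.
Qed.

(** Dominated convergence is applied to the squared errors, whose integrals therefore tend to 0. *)
Lemma in_closure_dominated (F : (T -> R[i])^nat) h (b : T -> R) :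
  sqint mu h -> (forall n, in_closure (F n)) ->
  {ae mu, forall t, (fun n => nsq (h t - F n t)) @ \oo --> (0 : R)} ->
  mu.-integrable setT (EFin \o b) -> (forall n t, nsq (h t - F n t) <= b t) ->
  in_closure h.
Proof.
move=> sh cF hF ib hb; apply: in_closure_limit => // eps eps0.
pose f_ (n : nat) t := (nsq (h t - F n t))%:E.
have mf n : measurable_fun setT (f_ n).
  by apply/measurable_EFinP/mC_nsq/mCB; [case: sh|case: (cF n) => -[]].
have [||_ _] := @dominated_convergence _ _ _ mu setT measurableT f_ (cst 0%E)
    (EFin \o b) mf (measurable_cst _) _ ib _.
- by apply: filterS hF => t ht _; apply: cvg_EFin => //; exact: nearW.
- by apply: aeW => t n _; rewrite /f_ /= lee_fin ger0_norm ?nsq_ge0// hb.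
rewrite integral_cst// mul0e => /fine_cvg /= cv.
have /cvgr0_norm_lt /(_ eps eps0) [n _ /(_ n (leqnn n)) hn] := cv.
exists (F n) => //; apply: le_lt_trans hn; exact: ler_norm.
Qed.

End SquareIntegrableClosure.

(** * Monomials in the closed span of the system *)

Section ArcSpan.
Context {R : realType}.
Variables (xi0 c : R).
Hypotheses (xi0_gt0 : 0 < xi0) (xi0_lt_pi : xi0 < pi).
Implicit Types (z : R[i]) (m n k : int) (r : bool) (t : measurableTypeR R).

Local Notation y := (arc_pole xi0).
Local Notation u := (expi c).
Local Notation sg := (arc_sigma xi0).
Local Notation B := (arc_blaschke xi0).
Local Notation E := (arc_kernel xi0 c).
Local Notation D z := ((1 - z * y) * (1 + z * y)).

Definition arc_family n t : R[i] := e_sys xi0 c n (expi t).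
Local Notation e_ := arc_family.

Let y1 : `|y| < 1 := norm_arc_pole_lt1 xi0_gt0 xi0_lt_pi.

Lemma sqint_arc_family n : sqint circ (e_ n).
Proof. exact: sqint_e_sys. Qed.

Lemma arc_pole_sqr_neq : 1 + y ^+ 2 != 0 /\ 1 - y ^+ 2 != 0.
Proof.
have y2 : `|y ^+ 2| < 1 by rewrite normrX expr_lt1.
split; first by rewrite -[y ^+ 2]mul1r circle_1add_neq0// normr1.
by rewrite -[y ^+ 2]mul1r -mulrN circle_1add_neq0 ?normr1// normrN.
Qed.

Lemma arc_sigma_neq0 : sg != 0.
Proof.
have [p1 _] := arc_pole_sqr_neq; apply: contraNneq p1 => s0.
by rewrite -arc_sigma_sqr// s0 expr0n.
Qed.

(* [E_0] and [E_1] span the same plane as [1 / D] and [z / D]. *)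
Lemma in_span_arc m r :
  in_span e_ (fun t => B (expi t) ^ m * (expi t ^+ r / D (expi t))).
Proof.
have u0 : u != 0 by exact: expi_neq0.
have [p1 p2] := arc_pole_sqr_neq; have s0 := arc_sigma_neq0.
have i0 := neq0Ci R[i]; have i2 := sqrCi R[i].
(* Up to constants E_0 is (1 - z y) / D and E_1 is (z - y) / D. The coefficients below come from (z
   - y) + y (1 - z y) = (1 - y^2) z and (1 - z y) + y (z - y) = 1 - y^2. *)
pose K := (sg * (1 - y ^+ 2))^-1.
have E0 t : e_ (m * 2 + false%:Z) t = B (expi t) ^ m * E false (expi t).
  by rewrite /arc_family e_sys_expiE.
have E1 t : e_ (m * 2 + true%:Z) t = B (expi t) ^ m * E true (expi t).
  by rewrite /arc_family e_sys_expiE.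
have S0 : in_span e_ (e_ (m * 2 + false%:Z)) by exact: in_span_basis.
have S1 : in_span e_ (e_ (m * 2 + true%:Z)) by exact: in_span_basis.
case: r.
  have := in_spanD (in_spanZ (K / 'i) S1) (in_spanZ (K * y / u) S0).
  rewrite (_ : (fun _ => _) = (fun t => B (expi t) ^ m * (expi t ^+ true / D (expi t))))//.
  apply/funext => t; rewrite E0 E1 arc_kernel0E// arc_kernel1E//.
  have [n1 n2 n3 n4] := arc_neq0 xi0_gt0 xi0_lt_pi (norm_expi t).
  by rewrite /K expr1; field; rewrite s0 i0 n3 n4 p2 u0.
have := in_spanD (in_spanZ (- K * 'i * y) S1) (in_spanZ (K / u) S0).
rewrite (_ : (fun _ => _) = (fun t => B (expi t) ^ m * (expi t ^+ false / D (expi t))))//.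
apply/funext => t; rewrite E0 E1 arc_kernel0E// arc_kernel1E//.
have [n1 n2 n3 n4] := arc_neq0 xi0_gt0 xi0_lt_pi (norm_expi t).
rewrite [LHS](_ : _ = B (expi t) ^ m * K * sg *
  ((1 - expi t * y) + - ('i ^+ 2) * y * (expi t - y)) / D (expi t)); last first.
  by rewrite /K; field; rewrite s0 n3 n4 p2 u0.
by rewrite i2 /K expr0; field; rewrite s0 n3 n4 p2.
Qed.

Lemma circle_D z : `|z| = 1 -> D z != 0.
Proof.
by move=> z1; have [_ _ n3 n4] := arc_neq0 xi0_gt0 xi0_lt_pi z1; rewrite mulf_neq0.
Qed.

(** Solving B = (w - y^2) / (1 - y^2 w) for w = z^2 gives w = (B + y^2) / (1 + y^2 B), a geometric
    series in [B]. The relation persists when [B] and w are both inverted, so one formula serves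
    positive and negative powers. *)
Lemma poly_limit_arc_square (eps : bool) (j : nat) :
  poly_limit (setT : set (measurableTypeR R))
    (fun t => if eps then B (expi t) else (B (expi t))^-1)
    (fun t => (if eps then expi t ^+ 2 else (expi t ^+ 2)^-1) ^+ j).
Proof.
set be := fun t => _.
have be1 t : [set: measurableTypeR R] t -> `|be t| <= 1.
  by move=> _; rewrite /be; case: ifP => _; rewrite ?normfV norm_blaschke_expi// invr1.
apply: poly_limitX => //.
apply: (eq_poly_limit (f := fun t => (be t + y ^+ 2) * (1 - - y ^+ 2 * be t)^-1)) => [t _|].
  have t1 := norm_expi t; have [n1 n2 n3 n4] := arc_neq0 xi0_gt0 xi0_lt_pi t1.
  have n0 := expi_neq0 t; have [p1 p2] := arc_pole_sqr_neq.
  rewrite /be; case: ifP => _; rewrite arc_blaschkeE//.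
    (* The denominator 1 + y^2 B in factored form, (1 - y^4) / D, which is visibly nonzero. *)
    rewrite (_ : 1 - - y ^+ 2 * _ = (1 - y ^+ 2) * (1 + y ^+ 2) / D (expi t)).
      by field; rewrite ?n0 ?n1 ?n2 ?n3 ?n4 ?p1 ?p2.
    by field; rewrite ?n0 ?n1 ?n2 ?n3 ?n4 ?p1 ?p2.
  rewrite (_ : 1 - - y ^+ 2 * _ = expi t ^+ 2 * ((1 - y ^+ 2) * (1 + y ^+ 2)) /
     ((expi t + y) * (expi t - y))).
    by field; rewrite ?n0 ?n1 ?n2 ?n3 ?n4 ?p1 ?p2.
  by field; rewrite ?n0 ?n1 ?n2 ?n3 ?n4 ?p1 ?p2.
apply: poly_limitM => //.
  by apply: poly_limitD; [exact: poly_limit_id|exact: poly_limit_cst].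
by apply: poly_limitV => //; rewrite normrN normrX expr_lt1.
Qed.

(** A polynomial in [B] or 1 / [B] close to the power of z^2, multiplied by z^r / D, is a
    combination of the functions of [in_span_arc]. *)
Lemma in_closure_arc_square (eps : bool) (j : nat) r :
  in_closure circ e_ (fun t => (if eps then expi t ^+ 2 else (expi t ^+ 2)^-1) ^+ j *
    (expi t ^+ r / D (expi t))).
Proof.
have mx : mC (expi : measurableTypeR R -> R[i]) := mC_expi.
have dD : disc_algebra (fun z => (1 - z * y)^-1 * (1 + z * y)^-1).
  by apply: disc_algebraM; [exact: disc_algebraVN|exact: disc_algebraV].
have [M hM] := disc_algebra_bounded dD.
have M0 : 0 <= M by rewrite -ler0c; apply: le_trans (hM 0).
apply: (in_closure_uniform sqint_arc_family).
  have mW := @mC_cst _ (measurableTypeR R) R.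
  apply: mCM.
    by apply: mCX; case: (eps); [exact: mCX|apply: mCV; exact: mCX].
  apply: mCM; first exact: mCX.
  by apply: mCV; apply: mCM; apply: mCD => //; [apply: mCN|]; exact: mCM.
(* [M] bounds |z^r / D| on the circle, so an error d / (M + 1) before multiplication leaves at most
   d. *)
move=> d d0; have d1 : 0 < d / (M + 1) by rewrite divr_gt0// ltr_wpDl.
have [|p hp] := poly_limit_arc_square eps j (e := (d / (M + 1))%:C%C).
  by rewrite ltcR.
pose be (t : measurableTypeR R) := if eps then B (expi t) else (B (expi t))^-1.
exists (fun t => p.[be t] * (expi t ^+ r / D (expi t))) => [|t].
  apply: in_closureS; first exact: sqint_arc_family.
  rewrite (_ : (fun _ => _) = fun t => \sum_(i < size p) p`_i *
      (B (expi t) ^ (if eps then i%:Z else - i%:Z) * (expi t ^+ r / D (expi t)))).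
    by apply: in_span_sum => i; apply: in_spanZ; exact: in_span_arc.
  apply/funext => t; rewrite horner_coef mulr_suml; apply: eq_bigr => i _.
  rewrite -mulrA; congr (_ * (_ * _)); rewrite /be; case: ifP => _//.
  by rewrite -exprz_inv.
rewrite -mulrBl normrM.
apply: (@le_trans _ _ ((d / (M + 1))%:C%C * M%:C%C)).
  apply: ler_pM => //; first exact: hp.
  by rewrite normrM normrX norm_expi expr1n mul1r invfM.
rewrite -rmorphM lecR mulrAC ler_pdivrMr ?ltr_wpDl//.
by rewrite ler_wpM2l ?ltW// ltrDl.
Qed.

(** Since D = 1 - y^2 z^2, one has z^(2j+r) = z^(2j) (z^r / D) - y^2 z^(2j+2) (z^r / D), for
    negative j as well. *)
Lemma in_closure_expiz k : in_closure circ e_ (fun t => expi t ^ k).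
Proof.
have S := sqint_arc_family.
have pos (j : nat) r := in_closure_arc_square true j r.
have neg (j : nat) r := in_closure_arc_square false j r.
have t1 t := norm_expi t.
have [j [r ->]] := int_doubleP k.
case: j => j.
  have := in_closureD S (pos j r) (in_closureZ S (- y ^+ 2) (pos j.+1 r)).
  rewrite (_ : (fun _ => _) = (fun t => expi t ^ (j%:Z * 2 + r%:Z)))//.
  apply/funext => t; have n0 := expi_neq0 t; have := circle_D (t1 t).
  rewrite mulf_eq0 negb_or => /andP[n3 n4].
  rewrite expfzDr// -PoszM -!exprnP mulnC exprM [_ ^+ j.+1]exprS.
  by field; rewrite n3 n4.
have := in_closureD S (neg j.+1 r) (in_closureZ S (- y ^+ 2) (neg j r)).
rewrite (_ : (fun _ => _) = (fun t => expi t ^ (Negz j * 2 + r%:Z)))//.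
apply/funext => t; have n0 := expi_neq0 t; have := circle_D (t1 t).
rewrite mulf_eq0 negb_or => /andP[n3 n4].
have -> : expi t ^ (Negz j * 2 + r%:Z) = expi t ^- 2 ^+ j.+1 * expi t ^+ r.
  by rewrite expfzDr// [Negz j * 2]mulrC -exprz_exp exprVn.
by rewrite exprS; field; rewrite n0 n3 n4.
Qed.

End ArcSpan.

(** * From indicators of a generating family to all square integrable functions *)

Section ClosureIndicators.
Context {d} {T : measurableType d} {R : realType} {I : eqType}.
Variables (mu : probability T R) (e : I -> T -> R[i]).
Hypothesis sqint_e : forall i, sqint mu (e i).
Implicit Types (f g : T -> R) (A : set T).

Local Notation W f := (in_closure mu e (fun t => (f t)%:C%C)).

Lemma cvg_nsq_real (a : R) (x : R^nat) : x @ \oo --> a ->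
  (fun n => nsq (a%:C%C - (x n)%:C%C)) @ \oo --> (0 : R).
Proof.
move=> xa; have -> : (fun n => nsq (a%:C%C - (x n)%:C%C)) = (fun n => (a - x n) ^+ 2).
  by apply/funext => n; rewrite -rmorphB nsq_real.
have -> : 0 = (a - a) ^+ 2 :> R by rewrite subrr expr0n.
by apply: cvgM; apply: cvgB => //; exact: cvg_cst.
Qed.

Lemma in_closure_dominated_real (F : (T -> R)^nat) f b :
  measurable_fun setT f ->
  mu.-integrable setT (fun t => (f t ^+ 2)%:E) ->
  (forall n, W (F n)) ->
  {ae mu, forall t, (fun n => F n t) @ \oo --> f t} ->
  mu.-integrable setT (EFin \o b) -> (forall n t, (f t - F n t) ^+ 2 <= b t) ->
  W f.
Proof.
move=> mf i2 cF hF ib hb.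
apply: (in_closure_dominated sqint_e (F := fun n t => (F n t)%:C%C) _ _ _ ib) => //.
- split; first exact: mC_real.
  by under eq_fun do rewrite nsq_real.
- by apply: filterS hF => t; exact: cvg_nsq_real.
- by move=> n t; rewrite -rmorphB nsq_real.
Qed.

Lemma in_closureB_real f g : W f -> W g -> W (fun t => f t - g t).
Proof.
move=> cf cg; have := in_closureD sqint_e cf (in_closureZ sqint_e (-1) cg).
by congr in_closure; apply/funext => t; rewrite rmorphB mulN1r.
Qed.

Lemma integrable_indic_sqr A : measurable A ->
  mu.-integrable setT (fun t => (\1_A t ^+ 2 : R)%:E).
Proof.
move=> mA; apply: (le_integrable measurableT _ _ (integrable_cst_prob mu 1)).
  by apply/measurable_EFinP; apply: measurable_funX; exact: measurable_indic.
move=> t _ /=; rewrite lee_fin indicE normr1.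
by case: (_ \in _); rewrite ?expr1n ?normr1 ?expr0n ?normr0.
Qed.

Hypothesis cT : W (\1_[set: T] : T -> R).

(** Disjointness makes the indicator of a finite union the sum of the indicators. The partial unions
    are eventually constant at each point, with squared error at most 1. *)
Lemma in_closure_bigcup (F : (set T)^nat) : (forall n, measurable (F n)) ->
  trivIset setT F -> (forall n, W (\1_(F n) : T -> R)) ->
  W (\1_(\bigcup_n F n) : T -> R).
Proof.
move=> mF tF cF.
pose S n : set T := \bigcup_(i < n) F i.
have cS n : W (\1_(S n) : T -> R).
  elim: n => [|n IH].
    rewrite /S bigcup_mkord big_ord0 indic0.
    have := in_closureZ sqint_e 0 cT; congr in_closure.
    by apply/funext => t; rewrite mul0r.
  have := in_closureD sqint_e IH (cF n); congr in_closure; apply/funext => t.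
  rewrite /S !bigcup_mkord big_ord_recr/= -!bigcup_mkord -rmorphD; congr (_%:C)%C.
  rewrite !indicE in_setU.
  case: (boolP (t \in F n)) => tn; last by rewrite orbF addr0.
  rewrite orbT; case: (boolP (t \in _)) => [|_]; last by rewrite add0r.
  rewrite inE => -[i /= lt_in Fi].
  have := tF i n Logic.I Logic.I.
  have : F i `&` F n !=set0 by exists t; split => //; rewrite inE in tn.
  by move=> h /(_ h) ni; rewrite ni ltnn in lt_in.
have mU : measurable (\bigcup_n F n) by exact: bigcupT_measurable.
apply: (in_closure_dominated_real (F := fun n => \1_(S n)) (b := cst 1)) => //.
- exact: integrable_indic_sqr.
- apply: aeW => t; rewrite indicE; case: (boolP (t \in _)) => tU.
    move: tU; rewrite inE => -[k _ Fk].
    apply: cvg_near_cst; exists k.+1 => // n /= kn.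
    by rewrite indicE mem_set//; exists k.
  apply: cvg_near_cst; exists 0%N => // n _ /=.
  rewrite indicE memNset// => -[k _ Fk].
  by move/negP: tU; apply; rewrite inE; exists k.
- exact: integrable_cst_prob.
- move=> n t; rewrite !indicE.
  by do 2 case: (_ \in _); rewrite ?subrr ?subr0 ?sub0r ?sqrrN ?expr0n ?expr1n.
Qed.

(** The pi-lambda theorem: the sets whose indicator lies in the closure are stable under complement
    and countable disjoint union. *)
Lemma in_closure_generated (G : set (set T)) : @measurable _ T = <<s G >> ->
  setI_closed G -> (forall A, G A -> W (\1_A : T -> R)) ->
  forall A, measurable A -> W (\1_A : T -> R).
Proof.
move=> mG GI cG A; rewrite mG.
apply: (dynkin_induction (P := fun A => W (\1_A : T -> R)) mG GI) => //.
- move=> S mS cS; have := in_closureB_real cT cS; congr in_closure.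
  apply/funext => t; congr (_%:C)%C; rewrite !indicE in_setT in_setC.
  by case: (_ \in _); rewrite ?subrr ?subr0.
- exact: in_closure_bigcup.
Qed.

Hypothesis c_indic : forall A, measurable A -> W (\1_A : T -> R).

Import HBNNSimple.

Lemma in_closure_nnsfun (f : {nnsfun T >-> R}) : W f.
Proof.
have E : (fun t => (f t)%:C%C) = (fun t =>
    \sum_(r <- finmap.enum_fset (fset_set (range f)))
      r%:C%C * (\1_(f @^-1` [set r]) t)%:C%C).
  apply/funext => t; rewrite fimfunE fsbig_finite//= raddf_sum.
  by apply: eq_bigr => r _; rewrite /= rmorphM.
rewrite E; apply: in_closure_sum => //.
  have := in_closureZ sqint_e 0 cT; congr in_closure.
  by apply/funext => t; rewrite mul0r.
by move=> r; apply: in_closureZ => //; exact: c_indic.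
Qed.

(** The approximating simple functions stay between 0 and [f], so the squared errors are dominated
    by the integrable f^2. *)
Lemma in_closure_nneg f : measurable_fun setT f -> (forall t, 0 <= f t) ->
  mu.-integrable setT (fun t => (f t ^+ 2)%:E) -> W f.
Proof.
move=> mf f0 i2.
have mfE : measurable_fun setT (EFin \o f) by exact/measurable_EFinP.
pose F := nnsfun_approx measurableT mfE.
have cv t : (fun n => F n t) @ \oo --> f t.
  have := @cvg_nnsfun_approx _ _ _ _ measurableT _ mfE _ t Logic.I.
  by move=> /(_ (fun t _ => f0 t))/fine_cvg.
have ub n t : F n t <= f t.
  rewrite -(cvg_lim _ (cv t))//.
  apply: (nondecreasing_cvgn_le (u_ := fun n => F n t)) => [m k mk|]; last first.
    exact: cvgP (cv t).
  exact/lefP/nd_nnsfun_approx.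
apply: (in_closure_dominated_real (F := fun n => F n) (b := fun t => f t ^+ 2)) => //.
- by move=> n; exact: in_closure_nnsfun.
- by apply: aeW.
- move=> n t; rewrite ler_pXn2r ?nnegrE ?subr_ge0//.
  by rewrite gerBl.
Qed.

Lemma in_closure_real f : measurable_fun setT f ->
  mu.-integrable setT (fun t => (f t ^+ 2)%:E) -> W f.
Proof.
move=> mf i2.
have L (g : T -> R) : measurable_fun setT g -> (forall t, 0 <= g t <= `|f t|) -> W g.
  move=> mg gf; apply: in_closure_nneg => // [t|]; first by case/andP: (gf t).
  apply: (le_integrable measurableT _ _ i2).
    by apply/measurable_EFinP; exact: measurable_funX.
  move=> t _ /=; have /andP[g0 gle] := gf t.
  by rewrite lee_fin !normrX ler_pXn2r ?nnegrE// ger0_norm.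
have cp : W (fun t => Num.max (f t) 0).
  apply: L; first by apply: measurable_maxr => //; exact: measurable_cst.
  move=> t; rewrite le_max lexx orbT /=.
  by rewrite ge_max normr_ge0 ler_norm.
have cn : W (fun t => Num.max (- f t) 0).
  apply: L.
    by apply: measurable_maxr; [exact: measurable_funN|exact: measurable_cst].
  move=> t; rewrite le_max lexx orbT /=.
  by rewrite ge_max normr_ge0 -normrN ler_norm.
have := in_closureB_real cp cn; congr in_closure; apply/funext => t.
congr (_%:C)%C; rewrite /Num.max.
by have [h|h|->] := ltrgtP (f t) 0; rewrite ?oppr0 ?ltxx ?subrr// ?oppr_lt0 ?oppr_gt0 ?h
  ?subr0 ?opprK ?add0r// ltNge (ltW h)//= ?sub0r ?opprK ?subr0.
Qed.

Lemma in_closure_sqint (h : T -> R[i]) : sqint mu h -> in_closure mu e h.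
Proof.
move=> [[m1 m2] ih].
have L (g : T -> R) : measurable_fun setT g -> (forall t, g t ^+ 2 <= nsq (h t)) -> W g.
  move=> mg gh; apply: in_closure_real => //.
  apply: (le_integrable measurableT _ _ ih).
    by apply/measurable_EFinP; exact: measurable_funX.
  by move=> t _ /=; rewrite lee_fin !ger0_norm ?sqr_ge0 ?nsq_ge0.
have c1 : W (fun t => Re (h t)) by apply: L => // t; rewrite lerDl sqr_ge0.
have c2 : W (fun t => Im (h t)) by apply: L => // t; rewrite lerDr sqr_ge0.
have := in_closureD sqint_e c1 (in_closureZ sqint_e 'i%C c2); congr in_closure.
by apply/funext => t; rewrite -complexE.
Qed.

End ClosureIndicators.

(** * Density of trigonometric polynomials *)

Section SignIteration.
Context {R : realType}.
Implicit Types x a t : R.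

(* Newton-Schulz iteration: an odd polynomial whose iterates converge to the
   sign function on [-1, 1]. *)
Definition sign_step x : R := (3 * x - x ^+ 3) / 2.

(** 1 and -1 are both fixed and critical points of the polynomial, hence the squared factors in the
    two identities. *)
Lemma sign_step_bounds x : -1 <= x <= 1 -> -1 <= sign_step x <= 1.
Proof.
move=> /andP[x1 x2]; rewrite /sign_step; apply/andP; split.
  rewrite -subr_ge0 (_ : _ - _ = (1 + x) ^+ 2 * (2 - x) / 2); last by field.
  by rewrite divr_ge0// mulr_ge0 ?sqr_ge0//; lra.
rewrite -subr_ge0 (_ : _ - _ = (1 - x) ^+ 2 * (2 + x) / 2); last by field.
by rewrite divr_ge0// mulr_ge0 ?sqr_ge0//; lra.
Qed.

Lemma iter_sign_step_bounds n x : -1 <= x <= 1 -> -1 <= iter n sign_step x <= 1.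
Proof. by move=> hx; elim: n => //= n IH; exact: sign_step_bounds. Qed.

Lemma sign_stepN x : sign_step (- x) = - sign_step x.
Proof. by rewrite /sign_step; field. Qed.

Lemma iter_sign_stepN n x : iter n sign_step (- x) = - iter n sign_step x.
Proof. by elim: n => //= n ->; rewrite sign_stepN. Qed.

(** The iterates increase from x. With z the current iterate, the distance to 1 is multiplied by (2
    - z - z^2) / 2, which is at most 1 - x / 2 because z >= x. *)
Lemma iter_sign_step_pos n x : 0 < x <= 1 ->
  x <= iter n sign_step x <= 1 /\ 1 - iter n sign_step x <= (1 - x / 2) ^+ n.
Proof.
move=> /andP[x0 x1]; elim: n => [|n [IH1 IH2]] /=.
  by rewrite lexx x1 expr0; split => //; rewrite lerBlDr lerDl ltW.
move: IH1 IH2; set z := iter _ _ _ => /andP[xz z1] IH2.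
have z0 : 0 < z by lra.
have h1 : z <= sign_step z.
  rewrite -subr_ge0 (_ : _ - _ = z * (1 - z) * (1 + z) / 2);
    last by rewrite /sign_step; field.
  by rewrite divr_ge0// !mulr_ge0//; lra.
have hz : -1 <= z <= 1 by apply/andP; split; lra.
have /andP[_ h2] := sign_step_bounds hz.
split; first by rewrite h2 (le_trans xz h1).
rewrite (_ : 1 - _ = (1 - z) * ((2 - z - z ^+ 2) / 2)); last by rewrite /sign_step; field.
rewrite [leRHS]exprSr; apply: ler_pM => //; first by lra.
  rewrite divr_ge0// (_ : _ - _ = (1 - z) * (2 + z)); last by ring.
  by rewrite mulr_ge0//; lra.
have := sqr_ge0 z; lra.
Qed.

Lemma cvg_iter_sign_step x : -1 <= x <= 1 ->
  (fun n => iter n sign_step x) @ \oo --> Num.sg x.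
Proof.
have L z : 0 < z <= 1 -> (fun n => iter n sign_step z) @ \oo --> (1 : R).
  move=> hz; have /andP[z0 z1] := hz.
  apply: (@squeeze_cvgr _ _ _ _ (fun n => 1 - (1 - z / 2) ^+ n) (fun=> 1)).
  - apply: nearW => n; have [/andP[_ h1] h2] := iter_sign_step_pos n hz.
    by rewrite h1 andbT lerBlDr addrC -lerBlDr.
  - rewrite -[X in _ --> X]subr0; apply: cvgB; first exact: cvg_cst.
    by apply: cvg_expr; rewrite ger0_norm; lra.
  - exact: cvg_cst.
move=> /andP[x1 x2]; have [x0|x0|x0] := sgrP x.
- have -> : (fun n => iter n sign_step x) = (fun=> 0).
    apply/funext; elim=> [//|n IH] /=.
    by rewrite IH /sign_step; field.
  exact: cvg_cst.
- by apply: L; rewrite x0.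
- have -> : (fun n => iter n sign_step x) = (fun n => - iter n sign_step (- x)).
    by apply/funext => n; rewrite iter_sign_stepN opprK.
  by apply: cvgN; apply: L; rewrite oppr_gt0 x0 /=; lra.
Qed.

(* A trigonometric polynomial of the sign of [t - a] for [t] in ]0, 2 pi[. *)
Definition arc_cut a t : R := (cos (a / 2) - cos (t - a / 2)) / 2.

Lemma arc_cutE a t : arc_cut a t = sin (t / 2) * sin ((t - a) / 2).
Proof.
rewrite /arc_cut; have -> : a / 2 = t / 2 - (t - a) / 2 by field.
have -> : t - (t / 2 - (t - a) / 2) = t / 2 + (t - a) / 2 by field.
by rewrite cosB cosD; field.
Qed.

Lemma arc_cut_bounds a t : -1 <= arc_cut a t <= 1.
Proof.
rewrite /arc_cut; have := cos_geN1 (a / 2); have := cos_le1 (a / 2).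
have := cos_geN1 (t - a / 2); have := cos_le1 (t - a / 2).
by move=> *; apply/andP; split; lra.
Qed.

(** In the product form, t / 2 lies in ]0, pi[ and |t - a| / 2 is below pi, so the sign is that of t
    - a. *)
Lemma sg_arc_cut a t : 0 <= a <= 2 * pi -> 0 < t < 2 * pi -> t != a ->
  Num.sg (arc_cut a t) = if a < t then 1 else -1.
Proof.
move=> ha ht ta; rewrite arc_cutE sgrM.
rewrite (gtr0_sg (x := sin (t / 2))) ?mul1r; last by apply: sin_gt0_pi; lra.
case: ltP => ta'.
  by rewrite gtr0_sg//; apply: sin_gt0_pi; lra.
have ta2 : t < a by rewrite lt_neqAle ta.
rewrite ltr0_sg// (_ : (t - a) / 2 = - ((a - t) / 2)); last by field.
by rewrite sinN oppr_lt0; apply: sin_gt0_pi; lra.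
Qed.

End SignIteration.

(** * From trigonometric polynomials to indicators of half-lines *)

Section TrigonometricCompleteness.
Context {R : realType} {I : eqType}.
Implicit Types (t : measurableTypeR R).

(** A Laurent polynomial in [expi t], encoded as a polynomial over a power of [expi t], so that sums
    and products reduce to common denominators. *)
Definition trig_poly (h : measurableTypeR R -> R[i]) := exists (n : nat) (p : {poly R[i]}),
  forall t, h t = expi t ^- n * p.[expi t].

Lemma trig_polyD f g : trig_poly f -> trig_poly g -> trig_poly (fun t => f t + g t).
Proof.
move=> [n [p fE]] [m [q gE]]; exists (n + m)%N, ('X^m * p + 'X^n * q) => t.
rewrite fE gE hornerD !hornerM !hornerXn exprD; have := expi_neq0 t.
move: (expi t) => z z0; have zn : z ^+ n != 0 by rewrite expf_neq0.
have zm : z ^+ m != 0 by rewrite expf_neq0.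
by field; rewrite zn zm.
Qed.

Lemma trig_polyM f g : trig_poly f -> trig_poly g -> trig_poly (fun t => f t * g t).
Proof.
move=> [n [p fE]] [m [q gE]]; exists (n + m)%N, (p * q) => t.
by rewrite fE gE hornerM exprD invfM; ring.
Qed.

Lemma trig_poly_cst w : trig_poly (fun=> w).
Proof. by exists 0%N, w%:P => t; rewrite hornerC expr0 invr1 mul1r. Qed.

Lemma trig_poly_expi : trig_poly (fun t => expi t).
Proof. by exists 0%N, 'X => t; rewrite hornerX expr0 invr1 mul1r. Qed.

Lemma trig_poly_expiV : trig_poly (fun t => (expi t)^-1).
Proof. by exists 1%N, 1 => t; rewrite hornerC mulr1. Qed.

Lemma trig_poly_cos b : trig_poly (fun t => (cos (t - b))%:C%C).
Proof.
have E t : (cos (t - b))%:C%C =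
    2^-1 * (expi t * (expi b)^* + (expi t)^-1 * expi b) :> R[i].
  have h : expi t * (expi b)^* + (expi t * (expi b)^*)^* =
    2 * (Re (expi t * (expi b)^*))%:C%C := addcJ _.
  have h2 : (expi t * (expi b)^*)^* = (expi t)^-1 * expi b :> R[i].
    by rewrite rmorphM/= conjCK conj_expi.
  rewrite -h2 h mulKf ?pnatr_eq0//.
  by congr (_%:C)%C; rewrite ReM Re_conj Im_conj cosB mulrN opprK.
rewrite (funext E); apply: trig_polyM; first exact: trig_poly_cst.
apply: trig_polyD; apply: trig_polyM;
  by [exact: trig_poly_expi|exact: trig_poly_expiV|exact: trig_poly_cst].
Qed.

Lemma trig_poly_sign a n : trig_poly (fun t => (iter n sign_step (arc_cut a t))%:C%C).
Proof.
elim: n => [|n IH] /=.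
  have E t : (arc_cut a t)%:C%C =
      (2^-1)%:C%C * ((cos (a / 2))%:C%C + (-1) * (cos (t - a / 2))%:C%C) :> R[i].
    by rewrite /arc_cut mulN1r -rmorphB -rmorphM mulrC.
  rewrite (funext E); apply: trig_polyM; first exact: trig_poly_cst.
  apply: trig_polyD; first exact: trig_poly_cst.
  by apply: trig_polyM; [exact: trig_poly_cst|exact: trig_poly_cos].
set g := fun t => _ in IH.
have E t : (sign_step (iter n sign_step (arc_cut a t)))%:C%C =
    (2^-1)%:C%C * (3%:C%C * g t + (-1) * (g t * (g t * g t))) :> R[i].
  by rewrite /g mulN1r -!rmorphM -rmorphB -rmorphM /sign_step mulrC exprS expr2.
rewrite (funext E); apply: trig_polyM; first exact: trig_poly_cst.
apply: trig_polyD; apply: trig_polyM; try exact: trig_poly_cst; first exact: IH.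
by apply: trig_polyM; [|apply: trig_polyM]; exact: IH.
Qed.

(** Single points are null because the law is dominated by Lebesgue measure, and the complement of
    [0, 2 pi] is null because the density vanishes there. *)
Lemma ae_circ_interior a :
  {ae circ, forall t : measurableTypeR R, 0 < t < 2 * pi /\ t != a}.
Proof.
have pi0 := two_pi_gt0 (R := R).
have N1 (x : R) : circ.-negligible [set x].
  exists [set x]; split => //.
  have /null_content_dominatesP dom := dominates_uniform_prob pi0.
  by apply: dom; [exact: measurable_set1|exact: lebesgue_measure_set1].
have N2 : (@circ R).-negligible (~` `[0, 2 * pi]%classic).
  exists (~` `[0, 2 * pi]%classic); split => //.
    by apply: measurableC; exact: measurable_itv.
  by rewrite /circ /= /uniform_prob integral_uniform_pdf setICl integral_set0.
apply: negligibleS (negligibleU N2 (negligibleU (N1 0) (negligibleU (N1 (2 * pi)) (N1 a)))).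
move=> t /= ht; apply: contrapT => /not_orP[h1 /not_orP[h2 /not_orP[h3 h4]]].
apply: ht; split; last exact/eqP.
move: h1 => /contrapT /=; rewrite in_itv/= => /andP[t0 t2].
apply/andP; split; rewrite lt_neqAle ?t0 ?t2 andbT; apply/eqP => E.
  by apply: h2; rewrite /= E.
by apply: h3; rewrite /= E.
Qed.

Variable e : I -> measurableTypeR R -> R[i].
Hypothesis sqint_e : forall i, sqint circ (e i).
Hypothesis c_expi : forall k : int, in_closure circ e (fun t => expi t ^ k).

Lemma in_closure_trig h : trig_poly h -> in_closure circ e h.
Proof.
move=> [n [p hE]].
have -> : h = fun t => \sum_(i < size p) p`_i * expi t ^ (i%:Z - n%:Z).
  apply/funext => t; rewrite hE horner_coef mulr_sumr; apply: eq_bigr => i _.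
  by rewrite expfzDr ?expi_neq0// -exprnN -exprnP; ring.
apply: in_closure_sum => //; last by move=> i; exact: in_closureZ.
have := in_closureZ sqint_e 0 (c_expi 0); congr in_closure.
by apply/funext => t; rewrite mul0r.
Qed.

Local Notation W f := (in_closure circ e (fun t => (f t)%:C%C)).

Lemma in_closure_sign a : W (fun t => Num.sg (arc_cut a t)).
Proof.
have msg : measurable_fun [set: measurableTypeR R] (fun t => Num.sg (arc_cut a t)).
  apply: (measurable_fun_cvg (h := fun n t => iter n sign_step (arc_cut a t))) => [n|t _].
    exact: (in_closure_trig (trig_poly_sign a n)).1.1.1.
  by apply: cvg_iter_sign_step; exact: arc_cut_bounds.
(* The iterates and the sign take values in [-1, 1], so 4 bounds the squared error. *)
apply: (in_closure_dominated_real sqint_e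
    (F := fun n t => iter n sign_step (arc_cut a t)) (b := cst 4)) => //.
- apply: (le_integrable measurableT _ _ (integrable_cst_prob circ 1)).
    by apply/measurable_EFinP; apply: measurable_funX.
  move=> t _ /=; rewrite lee_fin normr1 ger0_norm ?sqr_ge0//.
  by case: sgrP => _; rewrite ?expr0n ?sqrrN ?expr1n.
- by move=> n; apply: in_closure_trig; exact: trig_poly_sign.
- by apply: aeW => t; apply: cvg_iter_sign_step; exact: arc_cut_bounds.
- exact: integrable_cst_prob.
- move=> n t /=; have /andP[h1 h2] := iter_sign_step_bounds n (arc_cut_bounds a t).
  by case: sgrP; nra.
Qed.

Lemma in_closure_1 : W (\1_[set: measurableTypeR R] : measurableTypeR R -> R).
Proof.
have := c_expi 0; congr in_closure; apply/funext => t.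
by rewrite indicE in_setT expr0z.
Qed.

(** Almost everywhere the indicator equals (1 + sg (arc_cut a t)) / 2 if a is in [0, 2 pi]; it
    equals 1 if a < 0 and 0 if a > 2 pi. *)
Lemma in_closure_ray a :
  W (\1_(`]a, +oo[%classic : set (measurableTypeR R)) : measurableTypeR R -> R).
Proof.
have mI : measurable (`]a, +oo[%classic : set (measurableTypeR R)) by exact: measurable_itv.
have L (f : measurableTypeR R -> R) : W f -> (forall t, 0 <= f t <= 1) ->
    (forall t, 0 < t < 2 * pi -> t != a -> f t = (a < t)%R%:R) ->
    W (\1_(`]a, +oo[%classic : set (measurableTypeR R)) : measurableTypeR R -> R).
  move=> cf f01 fE.
  (* The sequence is constant: dominated convergence only replaces a function by another one almost
     everywhere equal to it. *)
  apply: (in_closure_dominated_real sqint_e (F := fun=> f) (b := cst 1)) => //.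
  - exact: integrable_indic_sqr.
  - apply: filterS (ae_circ_interior a) => t [t0 ta].
    rewrite indicE mem_setE in_itv/= andbT -(fE t t0 ta); exact: cvg_cst.
  - exact: integrable_cst_prob.
  - move=> n t /=; have := f01 t; rewrite indicE; case: (_ \in _) => /=; nra.
have [a0|a0] := ltP a 0.
  apply: (L (fun=> 1)) => [|t|t /andP[t0 _] _].
  - by have := in_closure_1; congr in_closure; apply/funext => t; rewrite indicE in_setT.
  - by rewrite ler01 lexx.
  - by rewrite (lt_trans a0 t0).
have [a2|a2] := ltP (2 * pi) a.
  apply: (L (fun=> 0)) => [|t|t /andP[_ t2] _].
  - have := in_closureZ sqint_e 0 in_closure_1; congr in_closure.
    by apply/funext => t; rewrite mul0r.
  - by rewrite ler01 lexx.
  - by rewrite ltNge (ltW (lt_trans t2 a2)).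
apply: (L (fun t => (1 + Num.sg (arc_cut a t)) / 2)) => [|t|t t02 ta].
- have := in_closureZ sqint_e (2^-1)%:C%C
    (in_closureD sqint_e in_closure_1 (in_closure_sign a)).
  congr in_closure; apply/funext => t.
  by rewrite indicE in_setT -rmorphD -rmorphM mulrC.
- by case: sgrP => _; apply/andP; split; lra.
- by rewrite sg_arc_cut ?a0//; case: ltP => _; rewrite ?mulr1n ?mulr0n; lra.
Qed.

Lemma in_closure_circ h : sqint circ h -> in_closure circ e h.
Proof.
apply: in_closure_sqint => //; first exact: in_closure_1.
apply: (in_closure_generated sqint_e in_closure_1 (G := @RGenOInfty.G R)).
- exact: RGenOInfty.measurableE.
- move=> A B [x ->] [y ->]; exists (Num.max x y).
  by apply/seteqP; split => t /=; rewrite !in_itv/= !andbT gt_max => /andP.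
- by move=> A [x ->]; exact: in_closure_ray.
Qed.

End TrigonometricCompleteness.

(** * The two bases *)

Section ArcBases.
Context {R : realType}.
Variables (xi0 c : R).
Hypotheses (xi0_gt0 : 0 < xi0) (xi0_lt_pi : xi0 < pi).
Implicit Types (m n k : int) (f : R[i] -> R[i]).

Local Notation e_ := (e_sys xi0 c).

Lemma L2norm_lt f (eps : R) : 0 < eps ->
  \int[circ]_t nsq (f (expi t)) < eps ^+ 2 -> L2norm f < eps.
Proof.
move=> eps0 h; rewrite L2normE -(ger0_norm (ltW eps0)) -sqrtr_sqr ltr_sqrt//.
by rewrite exprn_gt0.
Qed.

Lemma e_sys_dense f (eps : R) : L2 f -> 0 < eps ->
  exists (s : seq int) (l : int -> R[i]),
    \int[circ]_t nsq (f (expi t) - \sum_(i <- s) l i * e_ i (expi t)) < eps ^+ 2.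
Proof.
move=> /L2P sf eps0.
have S := sqint_arc_family c xi0_gt0 xi0_lt_pi.
have [_ /(_ _ (exprn_gt0 2 eps0))[g [s [l [us gE]]] hg]] :=
  in_closure_circ S (in_closure_expiz c xi0_gt0 xi0_lt_pi) sf.
exists s, l; apply: le_lt_trans hg; rewrite le_eqVlt; apply/orP; left; apply/eqP.
by apply: eq_Rintegral => t _; rewrite gE.
Qed.

Lemma orthonormal_basis_L2 : orthonormal_basis L2 (fun n : int => e_ n).
Proof.
split; [by move=> n; exact: L2_e_sys|by move=> n k; exact: dotC_e_sys|].
move=> f Lf eps eps0; have [s [l h]] := e_sys_dense Lf eps0.
by exists s, l; exact: L2norm_lt.
Qed.

Lemma Rintegral_nsqD_orth (f g : measurableTypeR R -> R[i]) :
  sqint circ f -> sqint circ g -> cint circ (fun t => f t * (g t)^*) = 0 ->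
  \int[circ]_t nsq (f t + g t) = \int[circ]_t nsq (f t) + \int[circ]_t nsq (g t).
Proof.
move=> sf sg fg0; have [_ i1] := sf; have [_ i2] := sg.
have [i3 _] := sqint_mulJ sf sg.
have i3' : circ.-integrable setT (EFin \o (fun t => 2 * Re (f t * (g t)^*))).
  rewrite (_ : _ \o _ = (fun t => 2%:E * (Re (f t * (g t)^*))%:E)%E)//.
  exact: integrableZl.
have i12 : circ.-integrable setT (EFin \o (fun t => nsq (f t) + nsq (g t))).
  rewrite (_ : _ \o _ = (fun t => (nsq (f t))%:E + (nsq (g t))%:E)%E)//.
  exact: integrableD.
rewrite -RintegralD//.
transitivity (\int[circ]_t ((nsq (f t) + nsq (g t)) + 2 * Re (f t * (g t)^*))).
  apply: eq_Rintegral => t _; rewrite ReM Re_conj Im_conj /nsq ReD ImD; ring.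
rewrite RintegralD// RintegralZl//.
have -> : \int[circ]_t Re (f t * (g t)^*) = 0 by have := congr1 (@complex.Re R) fg0.
by rewrite mulr0 addr0.
Qed.

(** Start from an approximant in L^2. Its part [q] with negative indices is orthogonal to [f] and to
    the other part [p], so by Pythagoras dropping [q] does not increase the error. *)
Lemma orthonormal_basis_H2 : orthonormal_basis H2 (fun n : nat => e_ n%:Z).
Proof.
split; [by move=> n; exact: H2_e_sys|by move=> n k; exact: dotC_e_sys|].
move=> f Hf eps eps0; have Lf := Hf.1; have [s [l h]] := e_sys_dense Lf eps0.
have /L2P sf := Lf.
have S n : sqint circ (fun t => e_ n (expi t)) by exact: sqint_e_sys.
(* The nonnegative indices of the approximant, transported to [nat]. *)
pose s' := [seq absz i | i <- s & 0 <= i].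
exists s', (fun j : nat => l j%:Z); apply: L2norm_lt => //.
pose p t := \sum_(i <- s | 0 <= i) l i * e_ i (expi t).
pose q t := \sum_(i <- s | ~~ (0 <= i)) l i * e_ i (expi t).
have pE t : \sum_(j <- s') l j%:Z * e_ j%:Z (expi t) = p t.
  rewrite /s' big_map big_filter /p.
  by apply: eq_bigr => i i0; rewrite gez0_abs.
under eq_Rintegral do rewrite pE.
have sp : sqint circ p.
  rewrite /p; under eq_fun do rewrite -big_filter.
  by apply: sqint_sum => i; exact: sqintZ.
have sq : sqint circ (fun t => - q t).
  rewrite (_ : (fun _ => _) = (fun t =>
      \sum_(i <- [seq i <- s | ~~ (0 <= i)]) (- l i) * e_ i (expi t))).
    by apply: sqint_sum => i; exact: sqintZ.
  by apply/funext => t; rewrite big_filter -sumrN; apply: eq_bigr => i _; rewrite mulNr.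
apply: le_lt_trans h.
under [leRHS]eq_Rintegral do rewrite (bigID (fun i => 0 <= i))/= opprD addrA.
have sfp := sqintB sf sp.
rewrite (Rintegral_nsqD_orth sfp sq); first by rewrite lerDl Rintegral_nsq_ge0.
have o1 i : i < 0 -> cint circ (fun t => (f (expi t) - p t) * (e_ i (expi t))^*) = 0.
  move=> i0; rewrite (eq_cint_circ (k := fun t =>
      f (expi t) * (e_ i (expi t))^* - p t * (e_ i (expi t))^*)); last first.
    by move=> t; rewrite mulrBl.
  rewrite cintB; [|exact: sqint_mulJ|exact: sqint_mulJ].
  rewrite -[cint circ (fun t => f (expi t) * _)]/(dotC f (e_ i)) dotC_H2_e_sys// sub0r.
  rewrite (eq_cint_circ (k := fun t => \sum_(j <- [seq j <- s | 0 <= j])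
      l j * (e_ j (expi t) * (e_ i (expi t))^*))); last first.
    by move=> t; rewrite big_filter mulr_suml; apply: eq_bigr => j _; rewrite mulrA.
  have [|_ ->] := @cint_sum _ _ _ circ _ [seq j <- s | 0 <= j]
    (fun j t => l j * (e_ j (expi t) * (e_ i (expi t))^*)).
    by move=> j; apply: integCZ; exact: sqint_mulJ.
  rewrite big_filter big1 ?oppr0// => j j0.
  rewrite cintZ; last exact: sqint_mulJ.
  rewrite -[cint _ _]/(dotC (e_ j) (e_ i)) dotC_e_sys// gt_eqF ?mulr0//.
  exact: lt_le_trans j0.
rewrite (eq_cint_circ (k := fun t => \sum_(j <- [seq j <- s | ~~ (0 <= j)])
    (- (l j)^*) * ((f (expi t) - p t) * (e_ j (expi t))^*))); last first.
  move=> t; rewrite big_filter rmorphN/= rmorph_sum/= mulrN mulr_sumr -sumrN.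
  by apply: eq_bigr => j _; rewrite rmorphM/=; ring.
have [|_ ->] := @cint_sum _ _ _ circ _ [seq j <- s | ~~ (0 <= j)]
    (fun j t => (- (l j)^*) * ((f (expi t) - p t) * (e_ j (expi t))^*)).
  by move=> j; apply: integCZ; exact: sqint_mulJ.
rewrite big_filter big1// => j; rewrite -ltNge => j0.
by rewrite cintZ ?o1 ?mulr0//; exact: sqint_mulJ.
Qed.

End ArcBases.

(** * Coordinates of the CMV factors for constant coefficients *)

Section ConstantCMV.
Context {R : realType}.
Implicit Types (a : R[i]) (x : int -> R[i]) (m : int).

Local Notation rho a := (sqrtC (1 - `|a| ^+ 2)).

Lemma even_int_double m (r : bool) : even_int (m * 2 + r%:Z) = ~~ r.
Proof. by rewrite /even_int rpredDl ?dvdz_mull//; case: r. Qed.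

(** The blocks of the factor [false] sit on the pairs (2m+1, 2m+2), so an odd coordinate comes first
    in its block; for the factor [true] the pairs are (2m, 2m+1). *)
Lemma cmv_factor_false_odd a x m : cmv_factor false (fun=> a) x (m * 2 + true%:Z) =
  a^* * x (m * 2 + true%:Z) + rho a * x ((m + 1) * 2 + false%:Z).
Proof.
rewrite /cmv_factor even_int_double /= !mxE /= /cmv_rho.
by rewrite -addrA addr0 mulrDl.
Qed.

Lemma cmv_factor_false_even a x m : cmv_factor false (fun=> a) x (m * 2 + false%:Z) =
  rho a * x ((m - 1) * 2 + true%:Z) - a * x (m * 2 + false%:Z).
Proof.
rewrite /cmv_factor even_int_double /= !mxE /= /cmv_rho mulNr.
by rewrite (_ : m * 2 + 0 - 1 = (m - 1) * 2 + 1)//; lia.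
Qed.

Lemma cmv_factor_true_odd a x m : cmv_factor true (fun=> a) x (m * 2 + true%:Z) =
  rho a * x (m * 2 + false%:Z) - a * x (m * 2 + true%:Z).
Proof.
rewrite /cmv_factor even_int_double /= !mxE /= /cmv_rho mulNr.
by rewrite addrK addr0.
Qed.

Lemma cmv_factor_true_even a x m : cmv_factor true (fun=> a) x (m * 2 + false%:Z) =
  a^* * x (m * 2 + false%:Z) + rho a * x (m * 2 + true%:Z).
Proof.
by rewrite /cmv_factor even_int_double /= !mxE /= /cmv_rho addr0.
Qed.

End ConstantCMV.

(** * The multiplication operator *)

Section MultiplicationOperator.
Context {R : realType}.
Variables (xi0 c : R) (a : R[i]).
Hypotheses (xi0_gt0 : 0 < xi0) (xi0_lt_pi : xi0 < pi).
Hypothesis aE : a = expi c * (sin (xi0 / 2))%:C%C.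
Implicit Types (m n : int) (r : bool) (f : R[i] -> R[i]).

Local Notation y := (arc_pole xi0).
Local Notation u := (expi c).
Local Notation sg := (arc_sigma xi0).
Local Notation B := (arc_blaschke xi0).
Local Notation E := (arc_kernel xi0 c).
Local Notation e_ := (e_sys xi0 c).
Local Notation s := ((sin (xi0 / 2))%:C%C : R[i]).
Local Notation rho := (sqrtC (1 - `|a| ^+ 2)).
Local Notation b1 := (b_kappa xi0).
Local Notation b2 := (b_kappabar xi0).
Local Notation v := (v_map xi0).

Lemma norm_arc_coef : `|a| = s.
Proof.
have /andP[s0 _] := sin_half_bounds xi0_gt0 xi0_lt_pi.
by rewrite aE normrM norm_expi mul1r ger0_norm// ler0c ltW.
Qed.

Lemma arc_coef_lt1 : `|a| < 1.
Proof.
have /andP[_ s1] := sin_half_bounds xi0_gt0 xi0_lt_pi.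
by rewrite norm_arc_coef ltcR.
Qed.

Lemma arc_pole_sqrE : y ^+ 2 = - (arc_tan xi0 ^+ 2)%:C%C.
Proof. by rewrite /arc_pole exprMn sqrCi mulN1r rmorphXn. Qed.

(** Together with [arc_rhoE] this makes both matrix entries rational in [y], so that the relations
    below become rational identities. *)
Lemma sin_half_arc_pole : s = (1 + y ^+ 2) / (1 - y ^+ 2).
Proof.
rewrite sin_half_arc_tan// arc_pole_sqrE opprK.
by rewrite rmorphM fmorphV/= rmorphB rmorphD rmorph1.
Qed.

(** With t = y / i = [arc_tan] the right side is 2 t / (1 + t^2), the nonnegative root of 1 - s^2
    for s = (1 - t^2) / (1 + t^2). *)
Lemma arc_rhoE : rho = 2 * y * 'i^-1 / (1 - y ^+ 2).
Proof.
have [_ p2] := arc_pole_sqr_neq xi0_gt0 xi0_lt_pi.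
have t0 := arc_tan_gt0 xi0_gt0 xi0_lt_pi.
have q0 : 0 < 1 + arc_tan xi0 ^+ 2 by rewrite addr_gt0// exprn_gt0.
have -> : 2 * y * 'i^-1 / (1 - y ^+ 2) = (2 * arc_tan xi0 / (1 + arc_tan xi0 ^+ 2))%:C%C.
  have -> : (2 * arc_tan xi0 / (1 + arc_tan xi0 ^+ 2))%:C%C =
      2 * (arc_tan xi0)%:C%C / (1 + (arc_tan xi0 ^+ 2)%:C%C) :> R[i].
    rewrite rmorphM fmorphV/= rmorphD rmorph1 rmorphM/=; congr (_ * _ / _).
    exact: (rmorph_nat (real_complex R) 2).
  rewrite arc_pole_sqrE opprK; congr (_ / _); rewrite /arc_pole -mulrA; congr (_ * _).
  by rewrite mulrAC mulfV ?mul1r// neq0Ci.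
have -> : 1 - `|a| ^+ 2 = ((2 * arc_tan xi0 / (1 + arc_tan xi0 ^+ 2))%:C%C : R[i]) ^+ 2.
  rewrite norm_arc_coef sin_half_arc_tan// -!rmorphXn -(rmorph1 (real_complex R)) -rmorphB.
  by congr (_%:C)%C; field; exact: lt0r_neq0.
rewrite sqrCK// ler0c; apply: divr_ge0; last exact: ltW.
by apply: mulr_ge0 => //; exact: ltW.
Qed.

Section OnCircle.
Variable z : R[i].
Hypothesis z1 : `|z| = 1.

Let k0 := sg / (1 + z * y).
Let k1 := sg / (1 - z * y).

Lemma arc_relation1 : rho * k1 - s * b1 z * k0 = b2 z * k1.
Proof.
have [n1 n2 n3 n4] := arc_neq0 xi0_gt0 xi0_lt_pi z1.
have [_ p2] := arc_pole_sqr_neq xi0_gt0 xi0_lt_pi.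
rewrite b_kappaE// b_kappabarE// arc_rhoE sin_half_arc_pole /k0 /k1.
(* [field] does not know that i^2 = -1: writing i as minus its inverse makes both sides linear in 1
   / i. *)
rewrite -[X in _ = X * _ * _]opprK -invCi.
by field; rewrite n3 n4 p2 neq0Ci.
Qed.

Lemma arc_relation2 : s * k1 + rho * b1 z * k0 = k0.
Proof.
have [n1 n2 n3 n4] := arc_neq0 xi0_gt0 xi0_lt_pi z1.
have [_ p2] := arc_pole_sqr_neq xi0_gt0 xi0_lt_pi.
rewrite b_kappaE// arc_rhoE sin_half_arc_pole /k0 /k1.
have iV : 'i^-1 * 'i^-1 = -1 :> R[i] by rewrite invCi mulrNN -expr2 sqrCi.
rewrite [X in _ + X](_ : _ = ('i^-1 * 'i^-1) * (2 * y / (1 - y ^+ 2) *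
  ((z + y) / (1 - z * y)) * (sg / (1 + z * y)))); last by ring.
by rewrite iV; field; rewrite n3 n4 p2.
Qed.

Lemma b_neq0 : b1 z != 0 /\ b2 z != 0.
Proof.
have := arc_blaschke_neq0 xi0_gt0 xi0_lt_pi z1.
by rewrite mulf_eq0 negb_or => /andP.
Qed.

Lemma v_map_conj : (v z)^* = (v z)^-1.
Proof.
have [n1 n2 n3 n4] := arc_neq0 xi0_gt0 xi0_lt_pi z1; have n0 := circle_neq0 z1.
rewrite /v_map b_kappaE// b_kappabarE//.
move: (arc_pole_conj xi0_gt0 xi0_lt_pi) n1 n2 n3 n4; move: y => w wJ n1 n2 n3 n4.
rewrite !(fmorphV, rmorphM, rmorphD, rmorphN, rmorph1)/= wJ conjCi (circle_conj z1).
by rewrite -invCi; field; rewrite n0 n1 n2 n3 n4 neq0Ci.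
Qed.

Let e00 m : e_ (m * 2 + false%:Z) z = B z ^ m * (k0 * u).
Proof. by rewrite e_sysE// arc_kernel0E. Qed.

Let e11 m : e_ (m * 2 + true%:Z) z = B z ^ m * (b2 z * k1).
Proof. by rewrite e_sysE// arc_kernel1E// -b_kappabarE. Qed.

Let BS m : B z ^ (m + 1) = B z ^ m * (b1 z * b2 z).
Proof.
by rewrite expfzDr ?(arc_blaschke_neq0 xi0_gt0 xi0_lt_pi z1)// expr1z.
Qed.

Let aJ : a^* = u^* * s.
Proof.
rewrite aE rmorphM/= (geC0_conj (x := s))// ler0c ltW//.
by have /andP[] := sin_half_bounds xi0_gt0 xi0_lt_pi.
Qed.

Let uuJ : u * u^* = 1.
Proof. by rewrite -normCK norm_expi expr1n. Qed.

(** Once a factor is taken out, the first parenthesis collapses to b2 k1 by [arc_relation1] and the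
    second to k0 by [arc_relation2]. The remaining outer combination has the form of
    [arc_relation2], or of [arc_relation1] in the odd case. *)
Lemma inv_v_map_e_sys_even m : (v z)^-1 * e_ (m * 2 + false%:Z) z =
  a * (rho * e_ ((m - 1) * 2 + true%:Z) z - a^* * e_ (m * 2 + false%:Z) z) +
  rho * (a * e_ (m * 2 + true%:Z) z + rho * e_ ((m + 1) * 2 + false%:Z) z).
Proof.
have [b10 b20] := b_neq0; have r1 := arc_relation1; have r2 := arc_relation2.
(* All powers of [B] are expressed through the lowest one, with exponent m - 1. *)
rewrite !e00 !e11 BS -{1 3 4 5}(subrK 1 m) BS aJ.
move: (rho) r1 r2 => rh r1 r2; rewrite aE /v_map invf_div.
move: (B z ^ (m - 1)) => Bm.
rewrite [RHS](_ : _ = u * Bm * b2 z * (s * (rh * k1 - (u * u^*) * s * b1 z * k0) +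
   rh * b1 z * b2 z * (s * k1 + rh * b1 z * k0))); last by ring.
rewrite uuJ mul1r r1 r2.
rewrite [RHS](_ : _ = u * Bm * b2 z ^+ 2 * (s * k1 + rh * b1 z * k0)); last by ring.
by rewrite r2; field; rewrite b10.
Qed.

Lemma inv_v_map_e_sys_odd m : (v z)^-1 * e_ (m * 2 + true%:Z) z =
  rho * (rho * e_ ((m - 1) * 2 + true%:Z) z - a^* * e_ (m * 2 + false%:Z) z) -
  a^* * (a * e_ (m * 2 + true%:Z) z + rho * e_ ((m + 1) * 2 + false%:Z) z).
Proof.
have [b10 b20] := b_neq0; have r1 := arc_relation1; have r2 := arc_relation2.
rewrite !e00 !e11 BS -{1 3 4 5}(subrK 1 m) BS aJ.
move: (rho) r1 r2 => rh r1 r2; rewrite aE /v_map invf_div.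
move: (B z ^ (m - 1)) => Bm.
rewrite [RHS](_ : _ = Bm * b2 z * (rh * (rh * k1 - (u * u^*) * s * b1 z * k0) -
   (u * u^*) * s * b1 z * b2 z * (s * k1 + rh * b1 z * k0))); last by ring.
rewrite uuJ !mul1r r1 r2.
rewrite [RHS](_ : _ = Bm * b2 z ^+ 2 * (rh * k1 - s * b1 z * k0)); last by ring.
by rewrite r1; field; rewrite b10.
Qed.

End OnCircle.

Lemma norm_v_map_expi t : `|v (expi t)| = 1.
Proof.
apply/eqP; rewrite -(@pexpr_eq1 _ _ 2)// normCK v_map_conj ?norm_expi//.
have [b10 b20] := b_neq0 (norm_expi t).
by rewrite mulfV// mulf_neq0// invr_eq0.
Qed.

Lemma mC_v_map : mC (fun t : measurableTypeR R => v (expi t)).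
Proof.
have mx : mC (@expi R : measurableTypeR R -> R[i]) := mC_expi.
have mW := @mC_cst _ (measurableTypeR R) R.
apply: (eq_mC (f := fun t : measurableTypeR R =>
   ('i^-1 * ((expi t + y) / (1 - expi t * y))) /
   ('i * ((expi t - y) / (1 + expi t * y))))) => [t|].
  by rewrite /v_map b_kappaE// b_kappabarE.
by repeat (apply: mCD || apply: mCN || apply: mCM || apply: mCV).
Qed.

Lemma L2_mul_v_map f : L2 f -> L2 (mul_op v f).
Proof.
move=> /L2P [mf sf]; apply/L2P; split.
  by apply: mCM; [exact: mC_v_map|exact: mf].
rewrite (_ : (fun _ => _) = (fun t => (nsq (f (expi t)))%:E))//.
apply/funext => t; rewrite /mul_op nsqM; congr (_%:E).
suff -> : nsq (v (expi t)) = 1 by rewrite mul1r.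
by apply: real_complex_inj; rewrite nsqE norm_v_map_expi expr1n.
Qed.

(** A row of the product of the two CMV factors involves four coordinates. *)
Lemma cint_lin4 (h1 h2 h3 h4 : measurableTypeR R -> R[i]) (w1 w2 w3 w4 : R[i]) :
  integC circ h1 -> integC circ h2 -> integC circ h3 -> integC circ h4 ->
  cint circ (fun t => w1 * h1 t + w2 * h2 t + w3 * h3 t + w4 * h4 t) =
  w1 * cint circ h1 + w2 * cint circ h2 + w3 * cint circ h3 + w4 * cint circ h4.
Proof.
move=> i1 i2 i3 i4; rewrite !cintD ?cintZ//; do ?exact: integCZ.
  by apply: integCD; exact: integCZ.
by do 2?apply: integCD; exact: integCZ.
Qed.

Lemma arc_operator : operator_in_basis e_ (mul_op v) (cmv (fun _ => a)).
Proof.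
move=> f Lf; split; first exact: L2_mul_v_map.
have /L2P sf := Lf.
have I n : integC circ (fun t => f (expi t) * (e_ n (expi t))^*).
  by apply: sqint_mulJ => //; exact: sqint_e_sys.
have rJ : rho^* = rho.
  rewrite geC0_conj// sqrtC_ge0 subr_ge0 exprn_ile1// ltW//; exact: arc_coef_lt1.
apply/funext => n; have [m [r ->]] := int_doubleP n.
(* As |v| = 1 on the circle, the coordinate of v f along e_n is the inner product of [f] with v^-1
   e_n; conjugating the expansion of v^-1 e_n gives row n of the matrix. *)
have vE t : f (expi t) * ((v (expi t))^-1 * e_ (m * 2 + r%:Z) (expi t))^* =
    mul_op v f (expi t) * (e_ (m * 2 + r%:Z) (expi t))^*.
  by rewrite rmorphM/= -v_map_conj ?norm_expi// conjCK /mul_op; ring.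
pose x := Defs.coord e_ f.
have X k : x k = cint circ (fun t => f (expi t) * (e_ k (expi t))^*) by [].
transitivity (cint circ (fun t => mul_op v f (expi t) * (e_ (m * 2 + r%:Z) (expi t))^*)).
  by [].
rewrite -(eq_cint_circ vE) /cmv /= -/x.
case: r vE => vE.
  rewrite cmv_factor_true_odd cmv_factor_false_odd cmv_factor_false_even.
  rewrite [RHS](_ : _ = rho * rho * x ((m - 1) * 2 + true%:Z) +
    (- (rho * a)) * x (m * 2 + false%:Z) + (- (a * a^*)) * x (m * 2 + true%:Z) +
    (- (a * rho)) * x ((m + 1) * 2 + false%:Z)); last by ring.
  rewrite !X -cint_lin4//; apply: eq_cint_circ => t.
  rewrite inv_v_map_e_sys_odd ?norm_expi//.
  rewrite !(rmorphB, rmorphD, rmorphM)/= !conjCK rJ; ring.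
rewrite cmv_factor_true_even cmv_factor_false_odd cmv_factor_false_even.
rewrite [RHS](_ : _ = a^* * rho * x ((m - 1) * 2 + true%:Z) +
  (- (a^* * a)) * x (m * 2 + false%:Z) + (rho * a^*) * x (m * 2 + true%:Z) +
  (rho * rho) * x ((m + 1) * 2 + false%:Z)); last by ring.
rewrite !X -cint_lin4//; apply: eq_cint_circ => t.
rewrite inv_v_map_e_sys_even ?norm_expi//.
rewrite !(rmorphB, rmorphD, rmorphM)/= !conjCK rJ; ring.
Qed.

End MultiplicationOperator.

Theorem theorem1p7 (R : realType) (xi0 c : R) (a : R[i])
    (xi0_gt0 : 0 < xi0) (xi0_lt_pi : xi0 < pi)
    (aE : a = expi c * (sin (xi0 / 2))%:C%C) :
  [/\ orthonormal_basis H2 (fun n : nat => e_sys xi0 c n%:Z),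
      orthonormal_basis L2 (fun n : int => e_sys xi0 c n),
      `|a| < 1
    & operator_in_basis (e_sys xi0 c) (mul_op (v_map xi0)) (cmv (fun _ => a))].
Proof.
split; [exact: orthonormal_basis_H2|exact: orthonormal_basis_L2| |].
  exact: arc_coef_lt1 xi0_gt0 xi0_lt_pi aE.
exact: arc_operator.
Qed.
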